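(* Let $R$ be an integer with $|R|\ge2$ and $B=\{0,b\}$ with $b\in\mathbb{Z}$, $b\ne0$. Let $L\subset\mathbb{Z}$ be finite with $0\in L$ and $(\alpha_l)_{l\in L}$ nonzero complex numbers with $\alpha_0=1$. The matrix $\frac{1}{\sqrt2}\left(e^{2\pi i lc/R}\alpha_l\right)_{l\in L,c\in B}$ has orthonormal columns if and only if the following four conditions hold: (i) $R=2^\alpha r$ with $\alpha\in\mathbb{N}$ ($\alpha\ge1$) and $r$ odd; (ii) $b=2^\beta q$ with $\beta\in\mathbb{N}\cup\{0\}$, $\beta\le\alpha-1$, and $q$ odd; (iii) every $l\in L\setminus\{0\}$ is of the form $l=2^{\alpha-1-\beta}s$ with $s$ odd and $qs$ divisible by $r$; (iv) $\sum_{l\in L\setminus\{0\}}|\alpha_l|^2=1$. If in addition (v) there exist $l_1,l_2\in L\setminus\{0\}$ with $l_1\not\equiv l_2\pmod R$, then $\left\{\Big(\prod_{j=0}^k\alpha_{l_j}\Big)e_{l_0+Rl_1+\dots+R^kl_k}: l_0\dots l_k\in\Omega(L)\right\}$ is a Parseval frame for $L^2(\mu(R,B))$.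
   Context: $\mu(R,B)$ is the unique Borel probability measure on $\mathbb{R}$ with $\mu(E)=\frac12(\mu(\tau_0^{-1}E)+\mu(\tau_b^{-1}E))$, $\tau_c(x)=(x+c)/R$. $e_\lambda(x)=e^{2\pi i\lambda x}$. $\Omega(L)$: the empty word (giving $e_0$ with weight 1) and all words $l_0\dots l_k$ with $l_i\in L$, $l_k\ne0$. Parseval frame: $\sum_i|\langle v,f_i\rangle|^2=\|v\|^2$ for all $v$. *)

(* Defs.v *)
From HB Require Import structures.
From mathcomp Require Import all_boot all_order all_algebra.
From mathcomp Require Import all_classical all_reals all_analysis.
From mathcomp Require Import complex.
Import Order.TTheory GRing.Theory Num.Theory.

Set Implicit Arguments.
Unset Strict Implicit.
Unset Printing Implicit Defensive.

Local Open Scope classical_set_scope.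
Local Open Scope ring_scope.

Section Defs.
Variable K : realType.

Definition ephase (x : K) : K[i] := Complex (cos (2 * pi * x)) (sin (2 * pi * x)).

Definition e_ (lam : int) (x : K) : K[i] := ephase (lam%:~R * x).

Definition tau (R c : int) (x : K) : K := (x + c%:~R) / R%:~R.

Definition selfsimilar (R b : int) (mu : probability K K) : Prop :=
  forall E : set K, measurable E ->
    mu E = ((2^-1 : K)%:E * (mu (tau R 0 @^-1` E) + mu (tau R b @^-1` E)))%E.

Definition Mentry (R : int) (alpha : int -> K[i]) (l c : int) : K[i] :=
  ((Num.sqrt (2 : K))^-1)%:C%C * ephase ((l * c)%:~R / R%:~R) * alpha l.

Definition orthonormal_columns (R b : int) (L : seq int) (alpha : int -> K[i]) :=
  forall c c' : int, c \in [:: 0; b] -> c' \in [:: 0; b] ->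
    \sum_(l <- L) Mentry R alpha l c * conjc (Mentry R alpha l c')
      = (c == c')%:R.

Definition conditions_i_iv (R b : int) (L : seq int) (alpha : int -> K[i]) :=
  (exists (a : nat) (r : int) (be : nat) (q : int),
     [/\ (1 <= a)%N /\ R = 2 ^+ a * r /\ odd (absz r),
         b = 2 ^+ be * q /\ (be <= a - 1)%N /\ odd (absz q)
       & forall l, l \in L -> l != 0 ->
           exists s : int, [/\ l = 2 ^+ (a - 1 - be) * s, odd (absz s)
                             & (r %| q * s)%Z]])
  /\ \sum_(l <- L | l != 0) Normc.normc (alpha l) ^+ 2 = 1.

Definition condition_v (R : int) (L : seq int) :=
  exists l1 l2 : int, [/\ l1 \in L, l2 \in L, l1 != 0, l2 != 0
                        & ~~ (R %| l1 - l2)%Z].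

Definition Omega (L : seq int) : set (seq int) :=
  [set w | all (fun l => l \in L) w /\ (w = [::] \/ last 0 w != 0)].

Definition freq (R : int) (w : seq int) : int :=
  \sum_(j < size w) R ^+ j * nth 0 w j.

Definition frame_elt (R : int) (alpha : int -> K[i]) (w : seq int) (x : K) : K[i] :=
  (\prod_(l <- w) alpha l) * e_ (freq R w) x.

Definition cintegral (mu : probability K K) (g : K -> K[i]) : K[i] :=
  Complex (fine (\int[mu]_x (complex.Re (g x))%:E)) (fine (\int[mu]_x (complex.Im (g x))%:E)).

Definition inL2 (mu : probability K K) (v : K -> K[i]) : Prop :=
  [/\ measurable_fun setT (fun x => complex.Re (v x)),
      measurable_fun setT (fun x => complex.Im (v x))
    & mu.-integrable setT (fun x => (Normc.normc (v x) ^+ 2)%:E)].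

Definition inner (mu : probability K K) (v f : K -> K[i]) : K[i] :=
  cintegral mu (fun x => v x * conjc (f x)).

Definition parseval_frame (I : choiceType) (Idx : set I) (mu : probability K K)
    (f : I -> K -> K[i]) : Prop :=
  forall v, inL2 mu v ->
    (\esum_(i in Idx) (Normc.normc (inner mu v (f i)) ^+ 2)%:E
      = \int[mu]_x (Normc.normc (v x) ^+ 2)%:E)%E.

End Defs.

(* Main.v *)
(* Write [S_l] for the map [f |-> alpha_l e_l f(R x)] on 1-periodic functions of
   [L^2(mu)].  Self-similarity computes its adjoint [dualop l], and orthonormality
   of the columns says [sum_l |dualop l v|^2 = |v|^2]; moreover [dualop 0 1 = 1].
   As [<v, f_(l w)> = <dualop l v, f_w>] and a final letter 0 does not change
   [f_w], the sum of [|<v, f_w>|^2] over the words of [Omega L] of length at most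
   [k] is [energy k v], which increases with [k] and is at most [|v|^2].  The [v]
   with [energy k v --> |v|^2] thus form a closed subspace, and since exponentials
   span a dense subspace it suffices to take [v = e_t] with [t] real.

   There [dualop l e_t] is a multiple of [e_((t - l) / R)], so
   [D_k(t) = 1 - energy k e_t] obeys a Markov recursion for the walk
   [t |-> (t - l) / R], the step [l] having weight [|alpha_l|^2 cos^2(pi b t / R)]
   if [l = 0] and [|alpha_l|^2 sin^2(pi b t / R)] otherwise.  If [D_k] does not
   tend to 0 on a compact interval, the points where [lim D_k] is maximal form a
   closed set closed under the possible steps and not containing 0.  From each of
   its points the path [t / R^k --> 0] is blocked, i.e. [b t / R^(k+1)] is a
   half-integer for some [k].  Hence all its points lie in [(1/b) Z]; following
   them along further steps, even in [(1/b') Z] with [b'] the part of [b] prime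
   to [R].  At a blocked point all steps [l != 0] are possible, so
   [b' (l1 - l2) / R] is an integer for all nonzero [l1], [l2] in [L], against
   (v). *)
Require Import Defs.
From HB Require Import structures.
From mathcomp Require Import all_boot all_order all_algebra.
From mathcomp Require Import all_classical all_reals all_analysis measurable_realfun.
From mathcomp Require Import complex.
From mathcomp Require Import ring lra zify.
Import Order.TTheory GRing.Theory Num.Theory.
Import numFieldNormedType.Exports.
Import HBNNSimple HBSimple.
Set Implicit Arguments.
Unset Strict Implicit.
Unset Printing Implicit Defensive.
Local Open Scope classical_set_scope.
Local Open Scope ring_scope.

Section Phase.
Variable K : realType.
Implicit Types (x y t : K) (z w : K[i]).

Definition nsq z : K := complex.Re z ^+ 2 + complex.Im z ^+ 2.

Lemma normc_sqr z : Normc.normc z ^+ 2 = nsq z.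
Proof.
by case: z => a c; rewrite /nsq /= sqr_sqrtr // addr_ge0 // sqr_ge0.
Qed.

Lemma nsq_ge0 z : 0 <= nsq z.
Proof. by rewrite addr_ge0 // sqr_ge0. Qed.

Lemma nsq_eq0 z : (nsq z == 0) = (z == 0).
Proof.
case: z => a c; rewrite eq_complex /nsq /= paddr_eq0 ?sqr_ge0 //.
by rewrite !sqrf_eq0.
Qed.

Lemma nsqM z w : nsq (z * w) = nsq z * nsq w.
Proof. by case: z w => a c [d e]; rewrite /nsq /=; ring. Qed.

Lemma nsqC z : nsq (conjc z) = nsq z.
Proof. by case: z => a c; rewrite /nsq /= sqrrN. Qed.

Lemma nsqR x : nsq x%:C%C = x ^+ 2.
Proof. by rewrite /nsq /= expr0n addr0. Qed.

Lemma mul_conjc z : z * conjc z = (nsq z)%:C%C.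
Proof. by case: z => a c; rewrite /nsq /real_complex_def; simpc; congr Complex; ring. Qed.

Lemma conjcM z w : conjc (z * w) = conjc z * conjc w.
Proof. by case: z w => a c [d e]; simpc; congr Complex; ring. Qed.

Lemma ephaseD x y : ephase (x + y) = ephase x * ephase y.
Proof.
rewrite /ephase mulrDr cosD sinD; simpc; congr Complex.
by rewrite addrC [_ * cos _]mulrC.
Qed.

Lemma ephase0 : ephase (0 : K) = 1.
Proof. by rewrite /ephase mulr0 cos0 sin0. Qed.

Lemma ephaseN x : ephase (- x) = conjc (ephase x).
Proof. by rewrite /ephase mulrN cosN sinN. Qed.

Lemma nsq_ephase x : nsq (ephase x) = 1.
Proof. by rewrite /nsq /= cos2Dsin2. Qed.

Lemma cos2pi_nat x n : cos (2 * pi * (x + n%:R)) = cos (2 * pi * x).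
Proof.
elim: n => [|n IHn]; first by rewrite addr0.
rewrite -[n.+1%:R]natr1 addrA [in LHS]mulrDr mulr1 -[RHS]IHn.
rewrite [X in _ + X]mulr_natl.
by rewrite cosD cos2pi sin2pi mulr1 mulr0 subr0.
Qed.

Lemma sin2pi_nat x n : sin (2 * pi * (x + n%:R)) = sin (2 * pi * x).
Proof.
elim: n => [|n IHn]; first by rewrite addr0.
rewrite -[n.+1%:R]natr1 addrA [in LHS]mulrDr mulr1 -[RHS]IHn.
rewrite [X in _ + X]mulr_natl.
by rewrite sinD cos2pi sin2pi mulr1 mulr0 addr0.
Qed.

Lemma ephaseDint x (n : int) : ephase (x + n%:~R) = ephase x.
Proof.
case: n => n; first by rewrite /ephase -pmulrn cos2pi_nat sin2pi_nat.
rewrite NegzE rmorphN /= -pmulrn.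
by rewrite /ephase -[in RHS](subrK n.+1%:R x) cos2pi_nat sin2pi_nat.
Qed.

Lemma cos2piDint x (n : int) : cos (2 * pi * (x + n%:~R)) = cos (2 * pi * x).
Proof. exact: (congr1 (@complex.Re K) (ephaseDint x n)). Qed.

Lemma cos2pi_half (n : int) : cos (2 * pi * (n%:~R + 2^-1)) = -1 :> K.
Proof. by rewrite addrC cos2piDint mulrAC divff ?mul1r ?cospi ?pnatr_eq0. Qed.

Lemma ephase_half (n : int) : ephase (n%:~R + 2^-1 : K) = -1.
Proof.
rewrite addrC ephaseDint /ephase mulrAC divff ?mul1r ?cospi ?sinpi ?pnatr_eq0 //.
by apply/eqP; rewrite eq_complex /= oppr0 !eqxx.
Qed.

Lemma cos2pi_eqN1 x : cos (2 * pi * x) = -1 -> exists n : int, x = n%:~R + 2^-1.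
Proof.
set n := Num.floor x; pose y := x - n%:~R.
have y_ge0 : 0 <= y by rewrite subr_ge0 floor_le_tmp.
have y_lt1 : y < 1 by rewrite ltrBlDl -[1]/(1%:~R) -intrD floorD1_gt.
have pi0 : 0 < (pi : K) := pi_gt0 K.
move=> hx; exists n.
have {hx}hy : cos (2 * pi * y) = -1 by rewrite /y -rmorphN cos2piDint.
suff : y = 2^-1 by rewrite /y => <-; rewrite addrC subrK.
have [y_le|y_ge] := leP y 2^-1.
  have : 2 * pi * y = pi.
    apply: cos_inj; rewrite ?cospi // ?in_itv /= ?lexx ?andbT //; last lra.
    by apply/andP; split; nra.
  by nra.
have : 2 * pi * (1 - y) = pi.
  apply: cos_inj; rewrite ?cospi // ?in_itv /= ?lexx ?andbT //.
  - by apply/andP; split; nra.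
  - lra.
  - by rewrite -[1 - y]opprB mulrN cosN -[-1 as X in y + X]/(((-1)%:~R)) cos2piDint.
by nra.
Qed.


Lemma Mentry_mul_conj (R : int) (alpha : int -> K[i]) (l c d : int) :
  Mentry R alpha l c * conjc (Mentry R alpha l d) =
  (2^-1 * nsq (alpha l))%:C%C * ephase ((l * (c - d))%:~R / R%:~R).
Proof.
rewrite /Mentry !conjcM -ephaseN conjc_real.
have -> : (l * (c - d))%:~R / R%:~R =
    (l * c)%:~R / R%:~R - (l * d)%:~R / R%:~R :> K.
  by rewrite -mulrBl -intrB mulrBr.
have -> : (2^-1 * nsq (alpha l))%:C%C = ((Num.sqrt 2)^-1)%:C%C *
    ((Num.sqrt 2)^-1)%:C%C * (alpha l * conjc (alpha l)) :> K[i].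
  rewrite mul_conjc -!rmorphM /= -expr2 exprVn sqr_sqrtr //.
rewrite ephaseD; ring.
Qed.

(* [l b / R] is a half-integer *)
Definition half_odd (R b l : int) := exists n : int, 2 * l * b = R * (2 * n + 1).

Lemma half_oddE (R b l : int) : R != 0 -> half_odd R b l ->
  exists n : int, b%:~R * l%:~R / R%:~R = n%:~R + 2^-1 :> K.
Proof.
move=> R0 [n hn]; exists n.
have R0' : R%:~R != 0 :> K by rewrite intr_eq0.
have := congr1 (fun z : int => z%:~R : K) hn; rewrite !(rmorphM, rmorphD) /=.
move=> h; apply: (mulIf R0'); rewrite mulfVK // [LHS]mulrC.
rewrite [RHS](_ : _ = 2^-1 * (R%:~R * ((1%:~R + 1%:~R) * n%:~R + 1%:~R))); last by field.
by rewrite -h mulrA; field.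
Qed.

Lemma half_oddE_inv (R b l : int) (n : int) : R != 0 ->
  (l * b)%:~R / R%:~R = n%:~R + 2^-1 :> K -> half_odd R b l.
Proof.
move=> R0 h; exists n; apply: (@intr_inj K).
have R0' : R%:~R != 0 :> K by rewrite intr_eq0.
move: h; rewrite !(rmorphM, rmorphD) /= => h.
have e : l%:~R * b%:~R = (n%:~R + 2^-1) * R%:~R :> K by rewrite -h mulfVK.
by rewrite -mulrA e; field.
Qed.

Lemma odd_absz_exists (m : int) : odd `|m|%N -> exists n : int, m = 2 * n + 1.
Proof. by move=> om; exists (m %/ 2)%Z; lia. Qed.

Lemma odd_abszD1 (n : int) : odd (absz (2 * n + 1)).
Proof. lia. Qed.

Lemma pow2_odd_decomp (x : int) : x != 0 ->
  exists (k : nat) (y : int), x = 2 ^+ k * y /\ odd `|y|%N.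
Proof.
move=> x0; have : (0 < `|x|)%N by rewrite absz_gt0.
move=> /(pfactor_coprime (isT : prime 2))[m cop e].
exists (logn 2 `|x|%N), (sgz x * m%:Z); split.
  have -> : 2 ^+ logn 2 `|x| * (sgz x * m) = sgz x * (m%:Z * 2%:Z ^+ logn 2 `|x|) by ring.
  by rewrite -rmorphXn /= natrXE -PoszM -e abszE; lia.
have -> : absz (sgz x * m%:Z) = m by move: x0; case: sgzP => // _ _; lia.
by rewrite -coprime2n.
Qed.

Lemma pow2_odd_inj (i j : nat) (x y : int) : odd `|x|%N -> odd `|y|%N ->
  2 ^+ i * x = 2 ^+ j * y -> i = j /\ x = y.
Proof.
move=> ox oy; elim: i j => [|i IHi] [|j] //=; rewrite ?expr0 ?mul1r //.
- by move=> e; move: ox; rewrite e exprS -mulrA abszM oddM.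
- by move=> e; move: oy; rewrite -e exprS -mulrA abszM oddM.
rewrite !exprS -!mulrA => e.
by have /IHi[-> ->] : 2 ^+ i * x = 2 ^+ j * y by apply: (@mulfI _ 2).
Qed.

Lemma conditions_half_odd (R b : int) (L : seq int) (alpha : int -> K[i]) :
  R != 0 -> b != 0 ->
  conditions_i_iv R b L alpha <->
  (forall l, l \in L -> l != 0 -> half_odd R b l) /\
  \sum_(l <- L | l != 0) Normc.normc (alpha l) ^+ 2 = 1.
Proof.
move=> R0 b0; split.
  case=> [[a] [r] [be] [q] [[a1 [eR or]] [eb [lebe oq]] hL]] hs; split=> // l lL l0.
  have [s [el os /dvdzP[m em]]] := hL l lL l0.
  have : odd `|m|%N.
    have : odd (absz (q * s)) by rewrite abszM oddM oq.
    by rewrite em abszM oddM => /andP[].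
  move=> /odd_absz_exists[n en]; exists n; rewrite -en eR el eb.
  rewrite [RHS](_ : _ = 2 ^+ a * (m * r)); last by ring.
  rewrite -em.
  have -> : 2 ^+ a = 2 * 2 ^+ (a - 1 - be) * 2 ^+ be :> int.
    by rewrite -exprS -exprD; congr (_ ^+ _); lia.
  ring.
case=> hL hs; split=> //.
have [l0 l0L l00] : exists2 l, l \in L & l != 0.
  apply: contrapT => noL; move: hs; rewrite big1_seq.
    by move/eqP; rewrite eq_sym oner_eq0.
  by move=> l /andP[l0 lL]; case: noL; exists l.
have [a [r [eR or]]] := pow2_odd_decomp R0.
have [be [q [eb oq]]] := pow2_odd_decomp b0.
have key l : l \in L -> l != 0 -> exists (k : nat) (s : int),
    [/\ l = 2 ^+ k * s, odd `|s|%N, (k + be).+1 = a & (r %| q * s)%Z].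
  move=> lL ln0; have [k [s [el os]]] := pow2_odd_decomp ln0.
  have [n en] := hL l lL ln0.
  have [|||e1 e2] := @pow2_odd_inj (k + be).+1 a (q * s) (r * (2 * n + 1)).
  - by rewrite abszM oddM oq.
  - by rewrite abszM oddM or odd_abszD1.
  - rewrite [RHS]mulrA -eR -en el eb exprS exprD; ring.
  by exists k, s; split=> //; rewrite e2 dvdz_mulr.
exists a, r, be, q; have [k0 [_ [_ _ ek0 _]]] := key l0 l0L l00.
split; first by split; [lia|].
  by split=> //; split=> //; lia.
move=> l lL ln0; have [k [s [el os ek hd]]] := key l lL ln0.
by exists s; split=> //; rewrite el (_ : (a - 1 - be)%N = k) //; move: ek; clear; lia.
Qed.

Lemma weight_sum (L : seq int) (alpha : int -> K[i]) (f : int -> K) :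
  uniq L -> 0 \in L -> alpha 0 = 1 ->
  \sum_(l <- L) nsq (alpha l) * f l =
  f 0 + \sum_(l <- L | l != 0) nsq (alpha l) * f l.
Proof.
by move=> uL L0 a0; rewrite (bigD1_seq 0) //= a0 -[1]/(1%:C%C) nsqR expr1n mul1r.
Qed.

Lemma Mentry_gram (R : int) (L : seq int) (alpha : int -> K[i]) (c d : int) :
  \sum_(l <- L) Mentry R alpha l c * conjc (Mentry R alpha l d) =
  \sum_(l <- L) (2^-1 * nsq (alpha l))%:C%C * ephase ((l * (c - d))%:~R / R%:~R).
Proof. by apply: eq_bigr => l _; exact: Mentry_mul_conj. Qed.

Lemma orthonormal_half_odd (R b : int) (L : seq int) (alpha : int -> K[i]) :
  R != 0 -> b != 0 -> uniq L -> 0 \in L ->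
  (forall l, l \in L -> alpha l != 0) -> alpha 0 = 1 ->
  orthonormal_columns R b L alpha <->
  (forall l, l \in L -> l != 0 -> half_odd R b l) /\
  \sum_(l <- L | l != 0) Normc.normc (alpha l) ^+ 2 = 1.
Proof.
move=> R0 b0 uL L0 an0 a0.
under eq_bigr do rewrite normc_sqr.
have diag c : \sum_(l <- L) (2^-1 * nsq (alpha l))%:C%C *
      ephase ((l * (c - c))%:~R / R%:~R) =
    (2^-1 * (1 + \sum_(l <- L | l != 0) nsq (alpha l)))%:C%C.
  have -> : 1 + \sum_(l <- L | l != 0) nsq (alpha l) =
      \sum_(l <- L) nsq (alpha l) * 1.
    by rewrite weight_sum //; congr (_ + _); apply: eq_bigr => l _; rewrite mulr1.
  rewrite mulr_sumr rmorph_sum; apply: eq_bigr => l _.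
  by rewrite subrr mulr0 mul0r ephase0 !mulr1.
have invR : (R%:~R : K) != 0 by rewrite intr_eq0.
split=> [ortho|[hL hs] c d].
  have := ortho 0 0; rewrite inE eqxx => /(_ isT isT).
  rewrite Mentry_gram diag => /(congr1 (@complex.Re K)) /= h1.
  have {}h1 : \sum_(l <- L | l != 0) nsq (alpha l) = 1 by lra.
  split=> // l lL l0.
  have := ortho b 0; rewrite !inE eqxx orbT => /(_ isT isT).
  rewrite Mentry_gram subr0 (negbTE b0) => /(congr1 (@complex.Re K)) h2.
  have {h2} : \sum_(l <- L) nsq (alpha l) * cos (2 * pi * ((l * b)%:~R / R%:~R)) = 0.
    apply: (@mulfI _ 2^-1); first by rewrite invr_eq0 pnatr_eq0.
    rewrite mulr0 -[RHS]h2 raddf_sum mulr_sumr; apply: eq_bigr => k _ /=.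
    by rewrite mul0r subr0 mulrA.
  rewrite weight_sum // mul0r mul0r mulr0 cos0 -{1}h1 -big_split /= => /eqP.
  rewrite psumr_eq0 => [/allP /(_ l lL)|k _]; last first.
    rewrite -{1}[nsq _]mulr1 -mulrDr mulr_ge0 ?nsq_ge0 //.
  rewrite l0 /= -{1}[nsq _]mulr1 -mulrDr mulf_eq0 nsq_eq0 (negbTE (an0 _ lL)) /=.
  rewrite addrC addr_eq0 => /eqP /cos2pi_eqN1[n hn].
  exact: half_oddE_inv hn.
have off (x : int) : x = b \/ x = - b ->
  \sum_(l <- L) (2^-1 * nsq (alpha l))%:C%C * ephase ((l * x)%:~R / R%:~R) = 0.
  move=> xb; rewrite (bigD1_seq 0) //= a0 mul0r mul0r ephase0 mulr1.
  have -> : nsq (1 : K[i]) = 1 by rewrite -[1]/(1%:C%C) nsqR expr1n.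
  rewrite mulr1.
  rewrite [X in _ + X](_ : _ = - (2^-1)%:C%C) ?subrr //.
  rewrite [in RHS](_ : 2^-1 = 2^-1 * \sum_(l <- L | l != 0) nsq (alpha l)); last first.
    by rewrite hs mulr1.
  rewrite mulr_sumr rmorph_sum -sumrN.
  rewrite big_seq_cond [RHS]big_seq_cond; apply: eq_bigr => l /andP[lL l0].
  suff -> : ephase ((l * x)%:~R / R%:~R) = -1 :> K[i] by rewrite mulrN1.
  have [n hn] := half_oddE R0 (hL l lL l0).
  case: xb => ->; first by rewrite rmorphM /= [l%:~R * _]mulrC hn ephase_half.
  rewrite mulrN rmorphN rmorphM /= [l%:~R * _]mulrC mulNr hn ephaseN ephase_half.
  by apply/eqP; rewrite eq_complex /= !oppr0 !eqxx.
rewrite !inE Mentry_gram => /orP[]/eqP-> /orP[]/eqP->.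
- by rewrite diag hs eqxx -[1%:R]/(1%:C%C); congr (_%:C%C); field.
- by rewrite off; [rewrite eq_sym (negbTE b0)|right; rewrite sub0r].
- by rewrite off; [rewrite (negbTE b0)|left; rewrite subr0].
- by rewrite diag hs eqxx -[1%:R]/(1%:C%C); congr (_%:C%C); field.
Qed.

End Phase.

Section SquareIntegrable.
Context {K : realType} (mu : probability K K).
Implicit Types (f g : K -> K) (u v w : K -> K[i]).

Definition rintegrable f := mu.-integrable setT (EFin \o f).

Definition cmeasurable v :=
  measurable_fun setT (fun x => complex.Re (v x)) /\
  measurable_fun setT (fun x => complex.Im (v x)).

Lemma rintegrable_measurable f : rintegrable f -> measurable_fun setT f.
Proof. by move=> /measurable_int /measurable_EFinP. Qed.

Lemma rintegrable_le f g : measurable_fun setT f -> rintegrable g ->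
  (forall x, `|f x| <= g x) -> rintegrable f.
Proof.
move=> mf ig fg; apply: le_integrable ig => //; first exact/measurable_EFinP.
by move=> x _ /=; rewrite lee_fin; apply: le_trans (fg x) (ler_norm _).
Qed.

Lemma rintegrable_cst (r : K) : rintegrable (cst r).
Proof. exact: finite_measure_integrable_cst. Qed.

Lemma rintegrableD f g : rintegrable f -> rintegrable g ->
  rintegrable (fun x => f x + g x).
Proof. by move=> hf hg; apply: eq_integrable (integrableD _ hf hg). Qed.

Lemma rintegrableZ (r : K) f : rintegrable f -> rintegrable (fun x => r * f x).
Proof. by move=> hf; apply: eq_integrable (integrableZl _ r hf). Qed.

Lemma Rintegral_cst_prob (r : K) : \int[mu]_x r = r.
Proof. by rewrite /Rintegral integral_cst //= probability_setT mule1. Qed.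

Lemma Rintegral_sqr_ge f : rintegrable f -> rintegrable (fun x => f x ^+ 2) ->
  (\int[mu]_x f x) ^+ 2 <= \int[mu]_x (f x ^+ 2).
Proof.
move=> hf hf2; set m := \int[mu]_x f x.
have e : \int[mu]_x (f x - m) ^+ 2 = \int[mu]_x (f x ^+ 2) - m ^+ 2.
  rewrite (_ : \int[mu]_x (f x - m) ^+ 2 =
    \int[mu]_x (f x ^+ 2 + ((- 2 * m) * f x + m ^+ 2))); last first.
    by apply: eq_Rintegral => x _; ring.
  rewrite RintegralD //; last 1 first.
    by have := rintegrableD (rintegrableZ (-2 * m) hf) (rintegrable_cst (m ^+ 2)).
  rewrite RintegralD //; [|exact: rintegrableZ|exact: rintegrable_cst].
  by rewrite RintegralZl // Rintegral_cst_prob -/m; ring.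
by rewrite -subr_ge0 -e Rintegral_ge0 // => x _; rewrite sqr_ge0.
Qed.

Definition nrm2 v : K := \int[mu]_x nsq (v x).

Lemma nsq_measurable v : cmeasurable v -> measurable_fun setT (fun x => nsq (v x)).
Proof.
by move=> [mr mi]; apply: measurable_funD; apply: measurable_funX.
Qed.

Lemma inL2P v : inL2 mu v <-> cmeasurable v /\ rintegrable (fun x => nsq (v x)).
Proof.
have e : (fun x => (Normc.normc (v x) ^+ 2)%:E) = (EFin \o (fun x => nsq (v x))).
  by apply/funext => x; rewrite normc_sqr.
by rewrite /inL2 e; split=> [[]|[[]]].
Qed.

Lemma nsqD_le (z w : K[i]) : nsq (z + w) <= 2 * nsq z + 2 * nsq w.
Proof.
case: z w => a c [d e]; rewrite /nsq /=.
have := sqr_ge0 (a - d); have := sqr_ge0 (c - e); nra.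
Qed.

Lemma cmeasurableD u v : cmeasurable u -> cmeasurable v ->
  cmeasurable (fun x => u x + v x).
Proof.
move=> [ur ui] [vr vi]; split.
- by apply: eq_measurable_fun (measurable_funD ur vr) => x _ /=; case: (u x) (v x) => ? ? [].
- by apply: eq_measurable_fun (measurable_funD ui vi) => x _ /=; case: (u x) (v x) => ? ? [].
Qed.

Lemma cmeasurableM u v : cmeasurable u -> cmeasurable v ->
  cmeasurable (fun x => u x * v x).
Proof.
move=> [ur ui] [vr vi]; split.
- apply: eq_measurable_fun (measurable_funB (measurable_funM ur vr) (measurable_funM ui vi)).
  by move=> x _ /=; case: (u x) (v x) => ? ? [].
- apply: eq_measurable_fun (measurable_funD (measurable_funM ur vi) (measurable_funM ui vr)).
  by move=> x _ /=; case: (u x) (v x) => ? ? [].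
Qed.

Lemma cmeasurable_cst (c : K[i]) : cmeasurable (fun=> c).
Proof. by split; exact: measurable_cst. Qed.

Lemma cmeasurableC v : cmeasurable v -> cmeasurable (fun x => conjc (v x)).
Proof.
move=> [vr vi]; split.
- by apply: eq_measurable_fun vr => x _ /=; case: (v x).
- apply: eq_measurable_fun (measurable_funB (@measurable_cst _ _ _ _ setT (0 : K)) vi) => x _ /=.
  by case: (v x) => ? ? /=; rewrite sub0r.
Qed.

Lemma cmeasurable_comp v (f : K -> K) : measurable_fun setT f -> cmeasurable v ->
  cmeasurable (fun x => v (f x)).
Proof.
move=> mf [vr vi]; split; first exact: (measurableT_comp vr mf).
exact: (measurableT_comp vi mf).
Qed.

Lemma inL2D u v : inL2 mu u -> inL2 mu v -> inL2 mu (fun x => u x + v x).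
Proof.
move=> /inL2P[mu1 iu] /inL2P[mv iv]; apply/inL2P; split; first exact: cmeasurableD.
apply: rintegrable_le (rintegrableD (rintegrableZ 2 iu) (rintegrableZ 2 iv)) _.
  by apply: nsq_measurable; exact: cmeasurableD.
by move=> x; rewrite ger0_norm ?nsq_ge0 // nsqD_le.
Qed.

Lemma inL2_mul_bounded (B : K) (g : K -> K[i]) v : cmeasurable g -> (forall x, nsq (g x) <= B) ->
  inL2 mu v -> inL2 mu (fun x => g x * v x).
Proof.
move=> mg gB /inL2P[mv iv]; apply/inL2P; split; first exact: cmeasurableM.
apply: rintegrable_le (rintegrableZ B iv) _; first by apply: nsq_measurable; exact: cmeasurableM.
by move=> x; rewrite ger0_norm ?nsq_ge0 // nsqM ler_wpM2r ?nsq_ge0.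
Qed.

Lemma inL2Z (c : K[i]) v : inL2 mu v -> inL2 mu (fun x => c * v x).
Proof. by apply: (@inL2_mul_bounded (nsq c)) => //; exact: cmeasurable_cst. Qed.

Lemma inL2_bounded (B : K) v : cmeasurable v -> (forall x, nsq (v x) <= B) -> inL2 mu v.
Proof.
move=> mv vB; apply/inL2P; split=> //.
apply: rintegrable_le (rintegrable_cst B) _; first exact: nsq_measurable.
by move=> x; rewrite ger0_norm ?nsq_ge0.
Qed.

Lemma inL2_Re v : inL2 mu v -> rintegrable (fun x => complex.Re (v x)).
Proof.
move=> /inL2P[[mr mi] iv].
apply: rintegrable_le mr (rintegrableD (rintegrable_cst 1) iv) _ => x /=.
case: (v x) => a c; rewrite /nsq /= ler_norml.
by have := sqr_ge0 (a - 1); have := sqr_ge0 (a + 1); have := sqr_ge0 c; nra.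
Qed.

Lemma inL2_Im v : inL2 mu v -> rintegrable (fun x => complex.Im (v x)).
Proof.
move=> /inL2P[[mr mi] iv].
apply: rintegrable_le mi (rintegrableD (rintegrable_cst 1) iv) _ => x /=.
case: (v x) => a c; rewrite /nsq /= ler_norml.
by have := sqr_ge0 (c - 1); have := sqr_ge0 (c + 1); have := sqr_ge0 a; nra.
Qed.

Lemma inL2_Re2 v : inL2 mu v -> rintegrable (fun x => complex.Re (v x) ^+ 2).
Proof.
move=> /inL2P[[mr mi] iv].
apply: rintegrable_le iv _; first exact: measurable_funX.
by move=> x; rewrite ger0_norm ?sqr_ge0 // lerDl sqr_ge0.
Qed.

Lemma inL2_Im2 v : inL2 mu v -> rintegrable (fun x => complex.Im (v x) ^+ 2).
Proof.
move=> /inL2P[[mr mi] iv].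
apply: rintegrable_le iv _; first exact: measurable_funX.
by move=> x; rewrite ger0_norm ?sqr_ge0 // lerDr sqr_ge0.
Qed.

Lemma cintegralE v :
  cintegral mu v = Complex (\int[mu]_x complex.Re (v x)) (\int[mu]_x complex.Im (v x)).
Proof. by []. Qed.

Lemma cintegralD u v : inL2 mu u -> inL2 mu v ->
  cintegral mu (fun x => u x + v x) = cintegral mu u + cintegral mu v.
Proof.
move=> hu hv; rewrite !cintegralE; simpc; congr Complex.
  rewrite -RintegralD //; [|exact: inL2_Re|exact: inL2_Re].
  by apply: eq_Rintegral => x _; case: (u x) (v x) => ? ? [].
rewrite -RintegralD //; [|exact: inL2_Im|exact: inL2_Im].
by apply: eq_Rintegral => x _; case: (u x) (v x) => ? ? [].
Qed.

Lemma cintegralZ (c : K[i]) v : inL2 mu v ->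
  cintegral mu (fun x => c * v x) = c * cintegral mu v.
Proof.
move=> hv; have [ir ii] := (inL2_Re hv, inL2_Im hv).
rewrite !cintegralE; case: c => a d; simpc; congr Complex.
  rewrite -!RintegralZl // -RintegralB //; [|exact: rintegrableZ|exact: rintegrableZ].
  by apply: eq_Rintegral => x _; case: (v x) => ? ?.
rewrite -!RintegralZl // -RintegralD //; [|exact: rintegrableZ|exact: rintegrableZ].
by apply: eq_Rintegral => x _; case: (v x) => ? ?.
Qed.

Lemma nsq_cintegral v : inL2 mu v -> nsq (cintegral mu v) <= nrm2 v.
Proof.
move=> hv; rewrite cintegralE /nsq /nrm2 /=.
rewrite RintegralD //; [|exact: inL2_Re2|exact: inL2_Im2].
apply: lerD; first exact: Rintegral_sqr_ge (inL2_Re hv) (inL2_Re2 hv).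
exact: Rintegral_sqr_ge (inL2_Im hv) (inL2_Im2 hv).
Qed.

Lemma nrm2Z (c : K[i]) v : inL2 mu v -> nrm2 (fun x => c * v x) = nsq c * nrm2 v.
Proof.
move=> /inL2P[_ iv]; rewrite /nrm2 -RintegralZl //.
by apply: eq_Rintegral => x _; rewrite nsqM.
Qed.

Lemma nsq_parallelogram (z w : K[i]) :
  nsq (z + w) + nsq (z - w) = 2 * nsq z + 2 * nsq w.
Proof. by case: z w => a c [d e]; rewrite /nsq /=; ring. Qed.

Lemma inL2N v : inL2 mu v -> inL2 mu (fun x => - v x).
Proof. by move=> /(inL2Z (-1)); under eq_fun do rewrite mulN1r. Qed.

Lemma nrm2_parallelogram u v : inL2 mu u -> inL2 mu v ->
  nrm2 (fun x => u x + v x) + nrm2 (fun x => u x - v x) = 2 * nrm2 u + 2 * nrm2 v.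
Proof.
move=> hu hv; rewrite /nrm2.
have /inL2P[_ i1] := inL2D hu hv.
have /inL2P[_ i2] := inL2D hu (inL2N hv).
move: hu hv => /inL2P[_ hu] /inL2P[_ hv].
rewrite -RintegralD // -!RintegralZl // -RintegralD //; try exact: rintegrableZ.
by apply: eq_Rintegral => x _; exact: nsq_parallelogram.
Qed.

End SquareIntegrable.

Section SelfSimilar.
Context {K : realType} (mu : probability K K) (R b : int).
Hypothesis ss : selfsimilar R b mu.

Lemma measurable_tau (c : int) : measurable_fun setT (tau R c : K -> K).
Proof.
rewrite /tau; apply: measurable_funM => //.
by apply: measurable_funD.
Qed.

Lemma ge0_integral_selfsimilar (f : K -> \bar K) :
  measurable_fun setT f -> (forall x, (0 <= f x)%E) ->
  (\int[mu]_x f x = (2^-1)%:E * (\int[mu]_x f (tau R 0 x) + \int[mu]_x f (tau R b x)))%E.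
Proof.
move=> mf f0.
have mt c := measurable_tau c.
have h0 : 0 <= 2^-1 :> K by rewrite invr_ge0.
pose t c : {mfun K >-> K} := mfun_Sub (mem_set (mt c)).
pose m c := distribution mu (t c).
rewrite (@eq_measure_integral _ _ _ _ (mscale (NngNum h0) (measure_add (m 0) (m b)))); last first.
  move=> A mA _; etransitivity; first exact: ss mA.
  by congr (_ * _)%E; exact/esym/measure_addE.
rewrite ge0_integral_mscale // ge0_integral_measure_add //.
by rewrite !ge0_integral_distribution.
Qed.

Lemma rintegrable_tau (f : K -> K) (c : int) : c \in [:: 0; b] ->
  rintegrable mu f -> rintegrable mu (fun x => f (tau R c x)).
Proof.
move=> cb hf.
have mf := rintegrable_measurable hf.
have mfc d : measurable_fun setT (fun x => f (tau R d x)).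
  exact: measurableT_comp mf (measurable_tau d).
apply/integrableP; split; first by apply/measurable_EFinP; exact: mfc.
have := @ge0_integral_selfsimilar (fun x => `|(f x)%:E|%E).
have /integrableP[_] := hf.
move=> fin /(_ _ _) e; rewrite e in fin => //; last first.
  by apply: measurableT_comp => //; exact/measurable_EFinP.
have i0 d : (0 <= \int[mu]_x `|(f (tau R d x))%:E|)%E by exact: integral_ge0.
move: fin; rewrite muleC -lte_pdivlMr // gt0_mulye ?lte_fin ?invr_gt0 // => fin.
apply: le_lt_trans fin.
by move: cb; rewrite !inE => /orP[]/eqP->; rewrite ?leeDl ?leeDr.
Qed.

Lemma Rintegral_selfsimilar (f : K -> K) : rintegrable mu f ->
  \int[mu]_x f x = 2^-1 * (\int[mu]_x f (tau R 0 x) + \int[mu]_x f (tau R b x)).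
Proof.
have in0 : 0 \in [:: 0; b] by rewrite inE eqxx.
have inb : b \in [:: 0; b] by rewrite !inE eqxx orbT.
have pos g : rintegrable mu g -> (forall x, 0 <= g x) ->
    \int[mu]_x g x = 2^-1 * (\int[mu]_x g (tau R 0 x) + \int[mu]_x g (tau R b x)).
  move=> ig g0; rewrite /Rintegral ge0_integral_selfsimilar //; last exact: measurable_int ig.
  have f0 : (\int[mu]_x (g (tau R 0 x))%:E)%E \is a fin_num.
    by have := integrable_fin_num measurableT (rintegrable_tau in0 ig).
  have fb : (\int[mu]_x (g (tau R b x))%:E)%E \is a fin_num.
    by have := integrable_fin_num measurableT (rintegrable_tau inb ig).
  by rewrite -[X in ((2^-1)%:E * (X + _))%E](fineK f0) -[X in (_ * (_ + X))%E](fineK fb).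
move=> hf; have ha : rintegrable mu (fun x => `|f x|).
  exact: integrable_abse hf.
have hs := rintegrableD ha hf.
have e g : rintegrable mu g -> rintegrable mu (fun x => `|g x|) ->
    \int[mu]_x g x = \int[mu]_x (`|g x| + g x) - \int[mu]_x `|g x|.
  move=> ig iag; rewrite -RintegralB //; last exact: rintegrableD.
  by apply: eq_Rintegral => x _; rewrite addrAC subrr add0r.
have t0 := rintegrable_tau in0; have tb := rintegrable_tau inb.
rewrite (e f) // (e (fun x => f (tau R 0 x))) ?(e (fun x => f (tau R b x))) //;
  try by [apply: t0|apply: tb|apply: (t0 (fun x => `|f x|))|apply: (tb (fun x => `|f x|))].
rewrite (pos _ hs) ?(pos _ ha) //; first by ring.
by move=> x; rewrite -lerBlDr sub0r -normrN ler_norm.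
Qed.

Lemma inL2_tau (v : K -> K[i]) (c : int) : c \in [:: 0; b] ->
  inL2 mu v -> inL2 mu (fun x => v (tau R c x)).
Proof.
move=> cb /inL2P[mv iv]; apply/inL2P; split.
  exact: cmeasurable_comp (measurable_tau c) mv.
exact: (rintegrable_tau cb iv).
Qed.

Lemma cintegral_selfsimilar (v : K -> K[i]) : inL2 mu v ->
  cintegral mu v = (2^-1)%:C%C * (cintegral mu (fun x => v (tau R 0 x)) +
                                  cintegral mu (fun x => v (tau R b x))).
Proof.
move=> hv; rewrite !cintegralE; simpc.
by rewrite !(Rintegral_selfsimilar (inL2_Re hv), Rintegral_selfsimilar (inL2_Im hv)).
Qed.

Lemma nrm2_selfsimilar (v : K -> K[i]) : inL2 mu v ->
  nrm2 mu v = 2^-1 * (nrm2 mu (fun x => v (tau R 0 x)) +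
                      nrm2 mu (fun x => v (tau R b x))).
Proof. by move=> /inL2P[_ iv]; exact: Rintegral_selfsimilar iv. Qed.

End SelfSimilar.

Lemma Rintegral_sum_seq (K : realType) (mu : probability K K) (I : Type) (s : seq I)
    (F : I -> K -> K) : (forall i, rintegrable mu (F i)) ->
  rintegrable mu (fun x => \sum_(i <- s) F i x) /\
  \int[mu]_x (\sum_(i <- s) F i x) = \sum_(i <- s) \int[mu]_x F i x.
Proof.
move=> hF; elim: s => [|i s [IH1 IH2]].
  under eq_fun do rewrite big_nil; split; first exact: rintegrable_cst.
  by rewrite big_nil Rintegral_cst_prob.
under eq_fun do rewrite big_cons; split; first exact: rintegrableD.
by rewrite big_cons -IH2 -RintegralD //; exact: hF.
Qed.

Section Exponential.
Context {K : realType} (mu : probability K K).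

Definition expt (t x : K) : K[i] := ephase (t * x).

Lemma cmeasurable_expt t : cmeasurable (expt t).
Proof.
have mt : measurable_fun setT (fun x : K => 2 * pi * (t * x)).
  by apply: measurable_funM => //; apply: measurable_funM.
split.
- apply: measurableT_comp mt; apply: continuous_measurable_fun; exact: continuous_cos.
- apply: measurableT_comp mt; apply: continuous_measurable_fun; exact: continuous_sin.
Qed.

Lemma nsq_expt t x : nsq (expt t x) = 1.
Proof. exact: nsq_ephase. Qed.

Lemma inL2_expt t : inL2 mu (expt t).
Proof.
by apply: (@inL2_bounded _ _ 1) => [|x]; [exact: cmeasurable_expt|rewrite nsq_expt].
Qed.

Lemma nrm2_expt t : nrm2 mu (expt t) = 1.
Proof.
rewrite -[RHS](Rintegral_cst_prob mu 1).
by apply: eq_Rintegral => x _; rewrite nsq_expt.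
Qed.

End Exponential.

Lemma coprime_part_decomp (b R : int) : b != 0 ->
  exists (b' b'' : int) (n : nat), [/\ b = b' * b'', coprimez R b' & (b'' %| R ^+ n)%Z].
Proof.
have [m] := ubnP (absz b); elim: m b => // m IHm b bm b0.
have [cop|ncop] := boolP (coprimez R b).
  by exists b, 1, 0%N; rewrite mulr1 expr0.
have /dvdzP[c ec] := dvdz_gcdr R b.
have gb : gcdz R b != 0 by rewrite gcdz_eq0 negb_and b0 orbT.
have c0 : c != 0 by apply: contra_neq b0 => c0; rewrite ec c0 mul0r.
have cm : (absz c < m)%N.
  have : (absz b = absz c * absz (gcdz R b))%N by rewrite {1}ec abszM.
  have : (1 < absz (gcdz R b))%N.
    rewrite ltn_neqAle absz_gt0 gb andbT eq_sym; apply: contra ncop => /eqP e.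
    by rewrite /coprimez -[gcdz R b]gez0_abs ?e.
  have : (0 < absz c)%N by rewrite absz_gt0.
  move: bm; move: (absz b) (absz c) (absz _) => x y z; clear; nia.
have [b' [b'' [n [e1 e2 e3]]]] := IHm c cm c0.
exists b', (b'' * gcdz R b), n.+1; split=> //; first by rewrite mulrA -e1.
by rewrite exprSr dvdz_mul // dvdz_gcdl.
Qed.

Section Walk.
Context {K : realType} (R b : int) (L : seq int) (c : int -> K) (D : nat -> K -> K).

Definition stepprob (l : int) (t : K) : K :=
  c l * ((1 + (if l == 0 then 1 else -1) * cos (2 * pi * (t * b%:~R / R%:~R))) / 2).

Hypothesis R2 : 2 <= `|R|.
Hypothesis b0 : b != 0.
Hypothesis c_gt0 : forall l, l \in L -> 0 < c l.
Hypothesis L0 : 0 \in L.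
Hypothesis hL : forall l, l \in L -> l != 0 -> half_odd R b l.
Hypothesis condv : condition_v R L.
Hypothesis sum_stepprob : forall t, \sum_(l <- L) stepprob l t = 1.
Hypothesis D_cont : forall k, continuous (D k).
Hypothesis D_decr : forall j k t, (j <= k)%N -> D k t <= D j t.
Hypothesis D_rec : forall k t,
  D k.+1 t = \sum_(l <- L) stepprob l t * D k ((t - l%:~R) / R%:~R).
Hypothesis D_ge0 : forall k t, 0 <= D k t.
Hypothesis D00 : D 0 0 = 0.

Let R0 : R != 0. Proof. by apply: contraTneq R2 => ->. Qed.
Let R0K : (R%:~R : K) != 0. Proof. by rewrite intr_eq0. Qed.
Let R2K : 2 <= `|R%:~R : K|.
Proof. by rewrite -intr_norm -[2]/(2%:~R) ler_int. Qed.

Let half_int (t : K) := exists n : int, t * b%:~R / R%:~R = n%:~R + 2^-1.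

Lemma stepprob_ge0 l t : l \in L -> 0 <= stepprob l t.
Proof.
move=> lL; rewrite mulr_ge0 ?(ltW (c_gt0 lL)) // divr_ge0 //.
set x := 2 * pi * _; have := cos_le1 x; have := cos_geN1 x.
by case: ifP => _; lra.
Qed.

Lemma stepprob0_gt0 t : ~ half_int t -> 0 < stepprob 0 t.
Proof.
move=> nh; rewrite lt_neqAle stepprob_ge0 // andbT eq_sym mulf_neq0 //.
  by rewrite gt_eqF ?c_gt0.
rewrite eqxx mul1r mulf_neq0 //; apply/eqP => e; apply: nh.
by apply: cos2pi_eqN1; lra.
Qed.

Lemma stepprob_gt0 l t : l \in L -> l != 0 -> half_int t -> 0 < stepprob l t.
Proof.
move=> lL l0 [n hn]; rewrite /stepprob hn (negbTE l0) cos2pi_half.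
by rewrite mulr_gt0 ?c_gt0 //; lra.
Qed.

Section Interval.
Variable C : K.
Hypothesis C_ge : forall l, l \in L -> `|l%:~R| <= C.

Lemma step_interval t l : l \in L -> `|t| <= C -> `|(t - l%:~R) / R%:~R| <= C.
Proof.
move=> lL tC; rewrite normrM normfV ler_pdivrMr ?normr_gt0 //.
apply: le_trans (ler_normB _ _) _; have := C_ge lL.
have C0 : 0 <= C := le_trans (normr_ge0 t) tC.
have : C * 2 <= C * `|R%:~R : K| by rewrite ler_wpM2l.
lra.
Qed.

Let inC t : (t \in `[-C, C]) = (`|t| <= C).
Proof. by rewrite in_itv /= ler_norml. Qed.

Let C0 : 0 <= C. Proof. by have := C_ge L0; rewrite normr0. Qed.

Lemma minimax : exists (x : nat -> K) (M : K),
  [/\ forall k, `|x k| <= C, forall k t, `|t| <= C -> D k t <= D k (x k),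
      forall k, M <= D k (x k) & forall e, 0 < e -> exists k, D k (x k) < M + e].
Proof.
have mx k : exists x, `|x| <= C /\ forall t, `|t| <= C -> D k t <= D k x.
  have [||x xC xM] := @EVT_max K (D k) (- C) C; first by rewrite (le_trans _ C0) // oppr_le0.
    by apply: continuous_subspaceT; exact: D_cont.
  by exists x; rewrite -inC; split=> // t; rewrite -inC; exact: xM.
have [x hx] := choice mx.
pose M := inf (range (fun k => D k (x k))).
have hinf : has_inf (range (fun k => D k (x k))).
  split; first by exists (D 0 (x 0)), 0%N.
  by exists 0 => _ [k _ <-].
exists x, M; split=> [k|k|k|e e0]; [exact: (hx k).1|exact: (hx k).2| |].
  by apply: ge_inf; [exact: hinf.2|exists k].
by have [_ [k _ <-] hk] := inf_adherent e0 hinf; exists k.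
Qed.

Section Trap.
Variables (x : nat -> K) (M : K).
Hypothesis xC : forall k, `|x k| <= C.
Hypothesis xmax : forall k t, `|t| <= C -> D k t <= D k (x k).
Hypothesis Mlb : forall k, M <= D k (x k).
Hypothesis Minf : forall e, 0 < e -> exists k, D k (x k) < M + e.
Hypothesis M_gt0 : 0 < M.

(* [M] is [inf_k max D_k] on [-C, C], so these are the maximisers of [lim D_k]. *)
Definition trap (t : K) := `|t| <= C /\ forall k, M <= D k t.

Lemma closed_superlevel k : closed [set t | M <= D k t].
Proof.
apply: (@closed_comp _ _ (D k) [set y | M <= y]); last exact: closed_ge.
by move=> t _; exact: D_cont.
Qed.

Lemma trap_nonempty : exists t, trap t.
Proof.
have cpt := @segment_compact K (- C) C.
have [|y [yC cy]] := cpt (x @ \oo) _.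
  by exists 0%N => // n _ /=; have := xC n; rewrite -inC.
exists y; split; first by rewrite -inC.
move=> k; apply: (@closed_superlevel k) => B nB; apply: cy nB.
by exists k => // n kn; apply: le_trans (Mlb n) _; exact: D_decr.
Qed.

Lemma trap_step t l : trap t -> l \in L -> 0 < stepprob l t ->
  trap ((t - l%:~R) / R%:~R).
Proof.
move=> [tC tM] lL; set p := stepprob l t => p0; split; first exact: step_interval.
move=> j; rewrite leNgt; apply/negP => lt_j.
pose d := M - D j ((t - l%:~R) / R%:~R).
have d0 : 0 < d by rewrite subr_gt0.
have [k1 hk1] := Minf (mulr_gt0 p0 d0).
pose k := maxn j k1; pose y l' := M + p * d - D k ((t - l'%:~R) / R%:~R).
have y_ge0 l' : l' \in L -> 0 <= stepprob l' t * y l'.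
  move=> l'L; rewrite mulr_ge0 ?stepprob_ge0 // subr_ge0.
  apply: le_trans (ltW hk1); apply: le_trans (xmax _ (step_interval l'L tC)).
  by apply: D_decr; exact: leq_maxr.
have : p * y l <= p * d.
  apply: (@le_trans _ _ (\sum_(l' <- L) stepprob l' t * y l')).
    rewrite (big_rem l) //= lerDl big_seq sumr_ge0 // => l' /mem_rem; exact: y_ge0.
  rewrite /y; under eq_bigr do rewrite mulrBr.
  rewrite sumrB -mulr_suml sum_stepprob mul1r -D_rec.
  by have := tM k.+1; lra.
have : M + p * d - (M - d) <= y l.
  have : D k ((t - l%:~R) / R%:~R) <= M - d.
    by rewrite /d subKr; apply: D_decr; exact: leq_maxl.
  rewrite /y; lra.
have := mulr_gt0 p0 d0; have := mulr_gt0 p0 (mulr_gt0 p0 d0).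
by nra.
Qed.

Lemma trap_blocked t : trap t -> exists k, trap (t / R%:~R ^+ k) /\ half_int (t / R%:~R ^+ k).
Proof.
move=> tt; apply: contrapT => nb.
have tr k : trap (t / R%:~R ^+ k).
  elim: k => [|k IHk]; first by rewrite expr0 divr1.
  have nq : ~ half_int (t / R%:~R ^+ k) by move=> q; apply: nb; exists k.
  have := trap_step IHk L0 (stepprob0_gt0 nq).
  by rewrite subr0 exprSr invfM mulrA.
have lim0 : (t / R%:~R ^+ k) @[k --> \oo] --> (0 : K).
  have q1 : `|(R%:~R : K)^-1| < 1.
    by rewrite normfV invf_lt1 ?normr_gt0 //; apply: lt_le_trans R2K; rewrite ltr1n.
  rewrite -(mulr0 t); under eq_fun do rewrite -exprVn.
  by apply: cvgMl_tmp; exact: cvg_expr.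
have : [set s | M <= D 0 s] 0.
  apply: (closed_cvg [set s | M <= D 0 s] (@closed_superlevel 0) _ _ lim0).
  by near=> k; exact: (tr k).2.
by rewrite /= D00 leNgt M_gt0.
Unshelve. all: by end_near.
Qed.

Lemma R_even : exists R' : int, R = 2 * R'.
Proof.
have [l [_ [lL _ l0 _ _]]] := condv.
have [n hn] := hL lL l0; exists (R %/ 2)%Z.
move: hn; rewrite -mulrA; move: (l * b) => m; clear; lia.
Qed.

Lemma trap_int t : trap t -> exists u : int, b%:~R * t = u%:~R.
Proof.
move=> tt; have [k [_ [n hn]]] := trap_blocked tt.
have [R' eR] := R_even; exists (R ^+ k * (R' * (2 * n + 1))).
have Rk : (R%:~R ^+ k : K) != 0 by rewrite expf_neq0.
have eb : t * b%:~R = (n%:~R + 2^-1) * R%:~R * R%:~R ^+ k.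
  by rewrite -hn mulfVK // mulrAC mulfVK.
have eRK : R%:~R = 2 * R'%:~R :> K by rewrite eR rmorphM.
rewrite mulrC eb rmorphM rmorphXn /= mulrC; congr (_ * _).
rewrite eRK !(rmorphM, rmorphD) /=; by field.
Qed.

Lemma trap_forward n t : trap t ->
  exists (N : int) (t' : K), trap t' /\ t = N%:~R + R%:~R ^+ n * t'.
Proof.
elim: n => [|n IHn] tt; first by exists 0, t; rewrite expr0 mul1r add0r.
have [N [t' [tt' et]]] := IHn tt.
have [l lL p0] : exists2 l, l \in L & 0 < stepprob l t'.
  apply: contrapT => no; have := sum_stepprob t'; rewrite big1_seq.
    by move/eqP; rewrite eq_sym oner_eq0.
  move=> l /= lL; apply/eqP; rewrite eq_le stepprob_ge0 // andbT leNgt.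
  by apply/negP => p0; apply: no; exists l.
exists (N + R ^+ n * l), ((t' - l%:~R) / R%:~R); split; first exact: trap_step.
rewrite et rmorphD rmorphM rmorphXn /= exprSr -addrA; congr (_ + _).
by field.
Qed.

Lemma trap_false : False.
Proof.
have [t0 tt0] := trap_nonempty; have [k [tt ht]] := trap_blocked tt0.
set t := t0 / _ in tt ht.
have [b' [b'' [n [eb cop /dvdzP[e ee]]]]] := coprime_part_decomp R b0.
have tint s : trap s -> exists w : int, b'%:~R * s = w%:~R.
  move=> ts; have [N [s' [ts' es]]] := trap_forward n ts.
  have [u hu] := trap_int ts'; exists (b' * N + e * u).
  rewrite es mulrDr rmorphD !rmorphM /= -hu eb -rmorphXn /= ee !rmorphM /=.
  congr (_ + _); ring.
have [l1 [l2 [l1L l2L l10 l20 /negP]]] := condv; apply.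
have [w1 h1] := tint _ (trap_step tt l1L (stepprob_gt0 l1L l10 ht)).
have [w2 h2] := tint _ (trap_step tt l2L (stepprob_gt0 l2L l20 ht)).
rewrite -(Gauss_dvdzr _ cop); apply/dvdzP; exists (w2 - w1).
apply: (@intr_inj K); rewrite !rmorphM !rmorphB /= -h1 -h2; by field.
Qed.

End Trap.
End Interval.

Lemma walk_converges t e : 0 < e -> exists k, D k t < e.
Proof.
move=> e0; pose C := `|t| + \sum_(l <- L) `|l%:~R : K|.
have C_ge l : l \in L -> `|l%:~R| <= C.
  move=> lL; rewrite /C (big_rem l) //= addrCA lerDl addr_ge0 // sumr_ge0 //.
have tC : `|t| <= C by rewrite lerDl sumr_ge0.
have [x [M [xC xmax Mlb Minf]]] := minimax C_ge.
have M0 : M <= 0.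
  by rewrite leNgt; apply/negP => M_gt0; exact: (trap_false C_ge xC xmax Mlb Minf M_gt0).
have [k hk] := Minf _ e0; exists k.
by apply: le_lt_trans (xmax k t tC) _; lra.
Qed.

End Walk.

Section SignIteration.
Context {K : realType}.

(* The iterates converge pointwise to the sign on [-1, 1], so polynomials in sines
   converge boundedly to indicators of half-lines. *)
Definition newton_sign (y : K) : K := (3 * y - y ^+ 3) / 2.

Lemma iter_newton_signN n y : iter n newton_sign (- y) = - iter n newton_sign y.
Proof. by elim: n => //= n ->; rewrite /newton_sign; ring. Qed.

Lemma iter_newton_sign_itv n (y : K) : 0 <= y <= 1 ->
  y <= iter n newton_sign y <= 1 /\
  1 - iter n newton_sign y <= (1 - y / 2) ^+ n.
Proof.
move=> /andP[y0 y1]; elim: n => [|n [/andP[lo hi] IHn]].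
  by rewrite /= lexx y1 expr0; split=> //; lra.
rewrite iterS exprSr; move: lo hi IHn; set z := iter n _ y => lo hi IHn.
have z0 : 0 <= z by apply: le_trans lo.
have e : 1 - newton_sign z = (1 - z) * ((1 - z) * (2 + z) / 2).
  by rewrite /newton_sign; field.
have lo1 : z <= newton_sign z.
  have -> : newton_sign z = z + z * (1 - z) * (1 + z) / 2 by rewrite /newton_sign; field.
  rewrite lerDl divr_ge0 // mulr_ge0 //; [rewrite mulr_ge0 //|]; lra.
have hi1 : newton_sign z <= 1.
  rewrite -subr_ge0 e mulr_ge0 ?subr_ge0 // divr_ge0 // mulr_ge0 ?subr_ge0 //; lra.
split; first by rewrite (le_trans lo lo1).
rewrite e ler_pM ?subr_ge0 //; first by rewrite divr_ge0 // mulr_ge0 ?subr_ge0 //; lra.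
have -> : (1 - z) * (2 + z) / 2 = 1 - z / 2 - z * z / 2 by field.
by have := mulr_ge0 z0 z0; lra.
Qed.

Lemma norm_iter_newton_sign n y : `|y| <= 1 -> `|iter n newton_sign y| <= 1.
Proof.
have pos (z : K) : 0 <= z <= 1 -> `|iter n newton_sign z| <= 1.
  move=> /[dup] /andP[z0 _] /(iter_newton_sign_itv n)[/andP[lo hi] _].
  by rewrite ger0_norm // (le_trans z0 lo).
have [y0|y0] := leP 0 y => y1.
  by apply: pos; rewrite y0 -(ger0_norm y0).
rewrite -[y]opprK iter_newton_signN normrN; apply: pos.
by rewrite oppr_ge0 (ltW y0) -ltr0_norm.
Qed.

Lemma cvg_iter_newton_sign y : `|y| <= 1 ->
  iter n newton_sign y @[n --> \oo] --> Num.sg y.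
Proof.
have pos (z : K) : 0 < z -> z <= 1 -> iter n newton_sign z @[n --> \oo] --> (1 : K).
  move=> z0 z1; have h n := iter_newton_sign_itv n (y := z).
  apply/subr_cvg0; apply/cvgNP; rewrite oppr0.
  have q : `|1 - z / 2| < 1 by rewrite ger0_norm; lra.
  apply: (squeeze_cvgr _ (cvg_cst 0) (cvg_expr q)); near=> n => /=.
  by have [|/andP[_ ?] ?] := h n; [rewrite ltW|rewrite opprB subr_ge0; apply/andP].
have [y0|y0|->] := ltrgtP y 0.
- rewrite ltr0_norm // ltr0_sg // => y1.
  have e n : iter n newton_sign y = - iter n newton_sign (- y).
    by rewrite iter_newton_signN opprK.
  under eq_fun do rewrite e.
  by apply: cvgN; apply: pos => //; rewrite oppr_gt0.
- by rewrite gtr0_norm // gtr0_sg //; exact: pos.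
- move=> _; rewrite sgr0.
  have e n : iter n newton_sign (0 : K) = 0.
    by elim: n => //= n ->; rewrite /newton_sign; ring.
  by under eq_fun do rewrite e; exact: cvg_cst.
Unshelve. all: by end_near.
Qed.

End SignIteration.

Section Density.
Context {K : realType} (mu : probability K K) (P : (K -> K[i]) -> Prop).
Hypothesis P_inL2 : forall v, P v -> inL2 mu v.
Hypothesis P_expt : forall t, P (expt t).
Hypothesis P_add : forall u v, P u -> P v -> P (fun x => u x + v x).
Hypothesis P_scale : forall c v, P v -> P (fun x => c * v x).
Hypothesis P_closed : forall v, inL2 mu v ->
  (forall e, 0 < e -> exists u, P u /\ nrm2 mu (fun x => v x - u x) < e) -> P v.

Inductive trigpoly : (K -> K[i]) -> Prop :=
| trig_expt t : trigpoly (expt t)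
| trig_add u v : trigpoly u -> trigpoly v -> trigpoly (fun x => u x + v x)
| trig_scale c v : trigpoly v -> trigpoly (fun x => c * v x).

Lemma trigpolyP v : trigpoly v -> P v.
Proof. by elim=> *; [exact: P_expt|exact: P_add|exact: P_scale]. Qed.

Lemma trig_mul u v : trigpoly u -> trigpoly v -> trigpoly (fun x => u x * v x).
Proof.
move=> tu; elim: tu v => [t|u1 u2 _ IH1 _ IH2|c u1 _ IH1] v tv.
- elim: tv => [s|v1 v2 _ IH1 _ IH2|c v1 _ IH1].
  + rewrite (_ : (fun _ => _) = expt (t + s)); first exact: trig_expt.
    by apply/funext => x; rewrite /expt mulrDl ephaseD.
  + by under eq_fun do rewrite mulrDr; exact: trig_add.
  + by under eq_fun do rewrite mulrCA; exact: trig_scale.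
- under eq_fun do rewrite mulrDl; apply: trig_add; [exact: IH1|exact: IH2].
- by under eq_fun do rewrite -mulrA; apply: trig_scale; exact: IH1.
Qed.

Definition rtrig (f : K -> K) := trigpoly (fun x => (f x)%:C%C).
Definition rP (f : K -> K) := P (fun x => (f x)%:C%C).

Lemma rtrigD f g : rtrig f -> rtrig g -> rtrig (fun x => f x + g x).
Proof.
move=> hf hg; rewrite /rtrig; under eq_fun do rewrite rmorphD; exact: trig_add.
Qed.

Lemma rtrigM f g : rtrig f -> rtrig g -> rtrig (fun x => f x * g x).
Proof.
move=> hf hg; rewrite /rtrig; under eq_fun do rewrite rmorphM; exact: trig_mul.
Qed.

Lemma rtrigZ (r : K) f : rtrig f -> rtrig (fun x => r * f x).
Proof.
move=> hf; rewrite /rtrig; under eq_fun do rewrite rmorphM; exact: trig_scale.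
Qed.

Lemma rtrig_sin s a : rtrig (fun x => sin (2 * pi * (s * (x - a)))).
Proof.
rewrite /rtrig (_ : (fun _ => _) = (fun x =>
    (Complex 0 (- 2^-1) * ephase (- (s * a))) * expt s x +
    (Complex 0 (2^-1) * ephase (s * a)) * expt (- s) x)).
  by apply: trig_add; apply: trig_scale; exact: trig_expt.
apply/funext => x; rewrite /expt -(mulrA (Complex 0 (- 2^-1))) -(mulrA (Complex 0 2^-1)) -!ephaseD.
have -> : - (s * a) + s * x = s * (x - a) by ring.
have -> : s * a + - s * x = - (s * (x - a)) by ring.
rewrite ephaseN /ephase; set c := cos _; set d := sin _.
by apply/eqP; rewrite eq_complex /=; apply/andP; split; apply/eqP; field.
Qed.

Lemma rtrig_newton_sign n f : rtrig f -> rtrig (fun x => iter n newton_sign (f x)).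
Proof.
move=> hf; elim: n => [//|n IHn] /=; set g := fun x => iter n _ _ in IHn.
rewrite (_ : (fun _ => _) =
    (fun x => (3 / 2) * g x + (- 2^-1) * (g x * (g x * g x)))); last first.
  by apply/funext => x; rewrite /newton_sign -/(g x); field.
by apply: rtrigD; apply: rtrigZ => //; apply: rtrigM => //; exact: rtrigM.
Qed.

Lemma rPD f g : rP f -> rP g -> rP (fun x => f x + g x).
Proof.
move=> hf hg; rewrite /rP; under eq_fun do rewrite rmorphD; exact: P_add.
Qed.

Lemma rPZ (r : K) f : rP f -> rP (fun x => r * f x).
Proof.
move=> hf; rewrite /rP; under eq_fun do rewrite rmorphM; exact: P_scale.
Qed.

Lemma rP1 : rP (fun=> 1).
Proof.
rewrite /rP (_ : (fun _ => _) = expt 0); first exact: P_expt.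
by apply/funext => x; rewrite /expt mul0r ephase0.
Qed.

Lemma rP_measurable f : rP f -> measurable_fun setT f.
Proof. by move=> /P_inL2 []. Qed.

Lemma rP_dominated (f : K -> K) (f_ : nat -> K -> K) (g : K -> K) :
  inL2 mu (fun x => (f x)%:C%C) -> (forall n, rP (f_ n)) ->
  (forall x, f_ n x @[n --> \oo] --> f x) ->
  rintegrable mu g -> (forall n x, (f x - f_ n x) ^+ 2 <= g x) -> rP f.
Proof.
move=> L2f Pf_ ff ig fg; apply: P_closed => // e e0.
have mf : measurable_fun setT f by case: L2f.
have cv : (\int[mu]_x ((f x - f_ n x) ^+ 2)%:E)%E @[n --> \oo] --> (\int[mu]_x (0 : K)%:E)%E.
  apply: (@dominated_cvg _ _ _ mu setT measurableT
    (fun n x => ((f x - f_ n x) ^+ 2)%:E) (fun=> 0%E) (EFin \o g)) => //.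
  - move=> n; apply/measurable_EFinP; apply: measurable_funX.
    by apply: measurable_funB => //; exact: rP_measurable.
  - move=> x _; apply: cvg_EFin; first by near=> n.
    have h : (f x - f_ n x) @[n --> \oo] --> (0 : K).
      by rewrite -(subrr (f x)); apply: cvgB; [exact: cvg_cst|exact: ff].
    have h2 : (f x - f_ n x) * (f x - f_ n x) @[n --> \oo] --> (0 * 0 : K) by exact: cvgM.
    by rewrite mul0r in h2; exact: h2.
  - move=> n x _ /=; rewrite lee_fin ger0_norm ?sqr_ge0 //.
rewrite integral0 in cv.
have /fine_cvgP[_ cvf] := cv.
have : \forall n \near \oo, fine (\int[mu]_x ((f x - f_ n x) ^+ 2)%:E)%E < e.
  exact: (cvgr_lt _ cvf).
case=> n _ /(_ n (leqnn n)) /= hn; exists (fun x => (f_ n x)%:C%C); split; first exact: Pf_.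
rewrite /nrm2 /Rintegral; apply: le_lt_trans hn.
rewrite le_eqVlt; apply/orP; left; apply/eqP; congr (fine _).
by apply: eq_integral => x _; rewrite -rmorphB nsqR.
Unshelve. all: by end_near.
Qed.

Lemma rP_bounded_limit (B : K) (f : K -> K) (f_ : nat -> K -> K) :
  (forall n, rP (f_ n)) -> (forall n x, `|f_ n x| <= B) ->
  (forall x, f_ n x @[n --> \oo] --> f x) -> rP f.
Proof.
move=> Pf_ fB ff.
have fB' x : `|f x| <= B.
  apply: (closed_cvg (fun y => `|y| <= B) _ _ _ (ff x)); last by near=> n.
  apply: (@closed_comp _ _ (fun y : K => `|y|) [set y | y <= B]); last exact: closed_le.
  by move=> y _; exact: norm_continuous.
have mf : measurable_fun setT f.
  by apply: (measurable_fun_cvg (h := f_)) => [n|x _]; [exact: rP_measurable|exact: ff].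
apply: (@rP_dominated f f_ (cst ((2 * B) ^+ 2))) => //; last 2 first.
- exact: rintegrable_cst.
- move=> n x; rewrite -real_normK ?num_real // ler_sqr ?nnegrE //.
    by apply: le_trans (ler_normB _ _) _; have := fB n x; have := fB' x; lra.
  by rewrite mulr_ge0 // (le_trans (normr_ge0 (f x))).
apply: (@inL2_bounded _ _ (B ^+ 2)).
  by split => //; exact: measurable_cst.
by move=> x; rewrite nsqR -real_normK ?num_real // ler_sqr ?nnegrE // (le_trans (normr_ge0 (f x))).
Unshelve. all: by end_near.
Qed.

Lemma rtrigP f : rtrig f -> rP f.
Proof. exact: trigpolyP. Qed.

Lemma sg_indic (y : K) : (Num.sg y * Num.sg y + Num.sg y) / 2 = ((0 < y)%R)%:R.
Proof.
have [y0|y0|->] := ltrgtP y 0.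
- by rewrite ltr0_sg // mulrNN mulr1 addrN mul0r.
- by rewrite gtr0_sg // mulr1 divff.
- by rewrite sgr0 mulr0 addr0 mul0r.
Qed.

Lemma rP_sin_pos s a : rP (fun x => ((0 < sin (2 * pi * (s * (x - a))))%R)%:R).
Proof.
pose q n x := iter n newton_sign (sin (2 * pi * (s * (x - a)))).
have sin1 x : `|sin (2 * pi * (s * (x - a)))| <= 1 by rewrite ler_norml sin_le1 sin_geN1.
have q1 n x : `|q n x| <= 1 by exact: norm_iter_newton_sign.
apply: (@rP_bounded_limit 1 _ (fun n x => 2^-1 * (q n x * q n x + q n x))).
- move=> n; apply: rtrigP; apply: rtrigZ.
  have tq : rtrig (q n) by apply: rtrig_newton_sign; exact: rtrig_sin.
  by apply: rtrigD => //; exact: rtrigM.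
- move=> n x; rewrite normrM ger0_norm ?invr_ge0 //.
  have : `|q n x * q n x + q n x| <= 2.
    apply: le_trans (ler_normD _ _) _; rewrite normrM.
    by have := ler_pM (normr_ge0 _) (normr_ge0 _) (q1 n x) (q1 n x); have := q1 n x; lra.
  lra.
- move=> x; rewrite -sg_indic mulrC.
  have cq := cvg_iter_newton_sign (sin1 x).
  by apply: cvgMl_tmp; apply: cvgD => //; exact: cvgM.
Qed.

Lemma rP_halfline (a : K) : rP (\1_`]a, +oo[).
Proof.
apply: (@rP_bounded_limit 1 _
  (fun n x => ((0 < sin (2 * pi * (n.+1%:R^-1 * (x - a))))%R)%:R)).
- by move=> n; exact: rP_sin_pos.
- by move=> n x; case: (_ < _)%R; rewrite ?normr1 ?normr0.
move=> x; apply: cvg_near_cst; near=> n.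
have [N hN] : exists N, N = n.+1%:R :> K by exists n.+1%:R.
have N0 : 0 < N by rewrite hN.
have Nbig : 2 * `|x - a| < N.
  rewrite hN; apply: (@le_lt_trans _ _ n%:R); last by rewrite ltr_nat.
  near: n; exact: nbhs_infty_ger.
rewrite -hN; set y := 2 * pi * (N^-1 * (x - a)).
have yE : y = 2 * (x - a) / N * pi by rewrite /y; ring.
have pi0 := pi_gt0 K.
rewrite indicE mem_setE in_itv /= andbT.
have [xa|ax] := leP x a; last first.
  suff -> : 0 < sin y by [].
  apply: sin_gt0_pi; rewrite yE pmulr_lgt0 // divr_gt0 ?mulr_gt0 ?subr_gt0 //=.
  rewrite gtr_pMl // ltr_pdivrMr // mul1r; apply: le_lt_trans Nbig.
  by rewrite ler_pM2l // ler_norm.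
suff -> : (0 < sin y) = false by [].
apply/negbTE; rewrite -leNgt -oppr_ge0 -sinN; apply: sin_ge0_pi.
have -> : - y = 2 * (a - x) / N * pi by rewrite yE; ring.
rewrite mulr_ge0 ?(ltW pi0) // ?divr_ge0 ?mulr_ge0 ?subr_ge0 ?(ltW N0) //=.
rewrite ler_piMl ?(ltW pi0) // ler_pdivrMr // mul1r; apply/ltW.
apply: le_lt_trans Nbig; by rewrite distrC ler_pM2l // ler_norm.
Unshelve. all: by end_near.
Qed.

Lemma rP_ext f g : (forall x, f x = g x) -> rP f -> rP g.
Proof. by move=> /funext ->. Qed.

Lemma rP_indic (A : set K) : measurable A -> rP (\1_A).
Proof.
move=> mA; pose G := @RGenOInfty.G K.
have mG : measurable = <<s G >> :> set (set K) := RGenOInfty.measurableE K.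
have : <<s G >> A by rewrite -mG.
apply: (@dynkin_induction _ _ G (fun A => rP (\1_A)) mG).
- move=> _ _ [x ->] [y ->]; exists (Num.max x y).
  by apply/seteqP; split=> z /=; rewrite !in_itv /= !andbT gt_max => /andP.
- by apply: rP_ext rP1 => x; rewrite indicT.
- by move=> _ [x ->]; exact: rP_halfline.
- move=> S _ PS; apply: rP_ext (rPD rP1 (rPZ (-1) PS)) => x.
  by rewrite indicC indicE mulN1r; case: (x \in S); rewrite ?subrr ?subr0.
move=> F mF tF PF; pose U n := [set x | exists2 i, (i < n)%N & F i x].
have PU n : rP (\1_(U n)).
  elim: n => [|n IHn].
    apply: rP_ext (rPZ 0 rP1) => x; rewrite mul0r indicE memNset //.
    by case.
  apply: rP_ext (rPD IHn (PF n)) => x.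
  rewrite !indicE; have [xn|xn] := boolP (x \in F n).
    rewrite [x \in U n.+1]mem_set; last by exists n => //; rewrite inE in xn.
    rewrite memNset ?add0r // => -[i lin Fi].
    have : i = n by apply: tF => //; exists x; split=> //; rewrite inE in xn.
    by move=> ein; rewrite ein ltnn in lin.
  rewrite addr0; congr (_%:R); congr nat_of_bool.
  apply/idP/idP; rewrite !inE => -[i lin Fi].
    by exists i => //; exact: ltnW.
  exists i => //; rewrite ltn_neqAle -ltnS lin andbT.
  by apply: contraNneq xn => <-; rewrite inE.
apply: (@rP_bounded_limit 1 _ (fun n => \1_(U n))) => // [n x|x].
  by rewrite indicE; case: (_ \in _); rewrite ?normr1 ?normr0.
apply: cvg_near_cst; have [[k _ Fk]|nF] := pselect ((\bigcup_k F k) x).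
  near=> n; rewrite !indicE !mem_set //; first by exists k.
  exists k => //; near: n; exact: nbhs_infty_gt.
near=> n; rewrite !indicE !memNset // => -[i _ Fi]; apply: nF; by exists i.
Unshelve. all: by end_near.
Qed.

Lemma rP_sum (I : Type) (s : seq I) (F : I -> K -> K) : (forall i, rP (F i)) ->
  rP (fun x => \sum_(i <- s) F i x).
Proof.
move=> hF; elim: s => [|i s IHs].
  by apply: rP_ext (rPZ 0 rP1) => x; rewrite big_nil mul0r.
by apply: rP_ext (rPD (hF i) IHs) => x; rewrite big_cons.
Qed.

Lemma rP_nnsfun (f : {nnsfun K >-> K}) : rP f.
Proof.
suff : rP (fun x => \sum_(y <- finmap.enum_fset (fset_set (range f))) y * \1_(f @^-1` [set y]) x).
  by apply: rP_ext => x; rewrite [RHS]fimfunE fsbig_finite //; exact: fimfunP.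
by apply: rP_sum => y; apply: rPZ; apply: rP_indic.
Qed.

Lemma rP_ge0 f : inL2 mu (fun x => (f x)%:C%C) -> (forall x, 0 <= f x) -> rP f.
Proof.
move=> L2f f0; have [mf _ _] := L2f; have [_ if2] := (inL2P _ _).1 L2f.
have mEf : measurable_fun setT (EFin \o f) by apply/measurable_EFinP.
pose f_ := nnsfun_approx measurableT mEf.
have cf x : f_ n x @[n --> \oo] --> f x.
  have := @cvg_nnsfun_approx _ _ _ _ measurableT _ mEf (fun x _ => f0 x) x I.
  by move/fine_cvgP => [].
apply: (@rP_dominated f f_ (fun x => nsq (f x)%:C%C)) => // [n|n x].
  exact: rP_nnsfun.
have le_f : f_ n x <= f x.
  have /cvg_lim <- // := cf x; apply: nondecreasing_cvgn_le; last exact: (cvgP _ (cf x)).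
  move=> i j ij; have /lefP := @nd_nnsfun_approx _ _ _ _ measurableT _ mEf i j ij; exact.
rewrite nsqR ler_sqr ?nnegrE ?subr_ge0 // lerBlDr lerDl.
exact: fun_ge0.
Qed.

Lemma trigpoly_dense v : inL2 mu v -> P v.
Proof.
have real f : inL2 mu (fun x => (f x)%:C%C) -> rP f.
  move=> L2f; have [mf _ _] := L2f; have [_ if2] := (inL2P _ _).1 L2f.
  have part (g : K -> K) : measurable_fun setT g -> (forall x, 0 <= g x <= `|f x|) -> rP g.
    move=> mg hg; apply: rP_ge0; last by move=> x; have /andP[] := hg x.
    apply/inL2P; split; first by split => //; exact: measurable_cst.
    apply: rintegrable_le if2 _; first exact: nsq_measurable.
    move=> x; rewrite !nsqR ger0_norm ?sqr_ge0 // -[leRHS]real_normK ?num_real //.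
    by have /andP[g0 gf] := hg x; rewrite ler_sqr ?nnegrE.
  apply: (@rP_ext (fun x => 2^-1 * (`|f x| + f x) + (- 1) * (2^-1 * (`|f x| + - f x)))).
    by move=> x; field.
  have mnf : measurable_fun setT (fun x => `|f x|) by exact: measurableT_comp.
  apply: rPD; [|apply: rPZ]; apply: part.
  - by apply: measurable_funM => //; exact: measurable_funD.
  - by move=> x; have := ler_norm (f x); have := ler_norm (- f x); rewrite normrN; lra.
  - by apply: measurable_funM => //; exact: measurable_funB.
  - by move=> x; have := ler_norm (f x); have := ler_norm (- f x); rewrite normrN; lra.
move=> L2v; have [mr mi _] := L2v.
have inR : inL2 mu (fun x => (complex.Re (v x))%:C%C).
  apply/inL2P; split; first by split => //; exact: measurable_cst.
  by have := inL2_Re2 L2v; under eq_fun do rewrite -nsqR.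
have inI : inL2 mu (fun x => (complex.Im (v x))%:C%C).
  apply/inL2P; split; first by split => //; exact: measurable_cst.
  by have := inL2_Im2 L2v; under eq_fun do rewrite -nsqR.
rewrite (_ : v = (fun x => (complex.Re (v x))%:C%C + 'i%C * (complex.Im (v x))%:C%C)).
  by apply: P_add; [exact: real|apply: P_scale; exact: real].
by apply/funext => x; exact: complexE.
Qed.

End Density.

Lemma continuous_sum_seq (K : realType) (I : Type) (s : seq I) (F : I -> K -> K) :
  (forall i, continuous (F i)) -> continuous (fun t => \sum_(i <- s) F i t).
Proof.
move=> cF t; elim: s => [|i s IHs].
  have -> : (fun t => \sum_(i <- [::]) F i t) = fun=> 0.
    by apply/funext => ?; rewrite big_nil.
  exact: cvg_cst.
have -> : (fun t => \sum_(i <- i :: s) F i t) = fun t => F i t + \sum_(i <- s) F i t.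
  by apply/funext => ?; rewrite big_cons.
by apply: cvgD => //; exact: cF.
Qed.

Section Frame.
Context {K : realType} (mu : probability K K) (R b : int) (L : seq int).
Variable alpha : int -> K[i].
Hypothesis R2 : 2 <= `|R|.
Hypothesis uL : uniq L.
Hypothesis L0 : 0 \in L.
Hypothesis alpha0 : alpha 0 = 1.
Hypothesis hL : forall l, l \in L -> l != 0 -> half_odd R b l.
Hypothesis hsum : \sum_(l <- L | l != 0) nsq (alpha l) = 1.
Hypothesis ss : selfsimilar R b mu.

Lemma R_neq0 : R != 0.
Proof. by apply: contraTneq R2 => ->. Qed.

Lemma intR_neq0 : (R%:~R : K) != 0.
Proof. by rewrite intr_eq0 R_neq0. Qed.

Let in0 : 0 \in [:: 0; b]. Proof. by rewrite inE eqxx. Qed.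
Let inb : b \in [:: 0; b]. Proof. by rewrite !inE eqxx orbT. Qed.

Definition csign (l : int) : K[i] := if l == 0 then 1 else -1.

Lemma e_tau_b l x : l \in L -> e_ l (tau R b x) = csign l * e_ l (tau R 0 x).
Proof.
move=> lL; rewrite /csign; have [->|l0] := eqVneq l 0.
  by rewrite /e_ !mul0r mul1r.
have [n hn] := half_oddE K R_neq0 (hL lL l0).
rewrite /e_ /tau addr0 mulrA mulrDr mulrDl [l%:~R * b%:~R]mulrC hn ephaseD.
by rewrite ephase_half mulrC -mulrA.
Qed.

(* The adjoint of [f |-> alpha_l e_l f(R x)] on 1-periodic functions, with
   [e_l (tau_b x)] replaced by [csign l * e_l (tau_0 x)]. *)
Definition dualop (l : int) (v : K -> K[i]) (x : K) : K[i] :=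
  (2^-1)%:C%C * conjc (alpha l) * conjc (e_ l (tau R 0 x)) *
  (v (tau R 0 x) + csign l * v (tau R b x)).

Lemma csign_conj l : conjc (csign l) = csign l.
Proof.
rewrite /csign; case: ifP => _; apply/eqP; rewrite eq_complex /= ?oppr0 !eqxx //.
Qed.

Lemma e_expt l : e_ l = expt (l%:~R : K).
Proof. by []. Qed.

Lemma inL2_dualop l v : inL2 mu v -> inL2 mu (dualop l v).
Proof.
move=> hv; apply: (@inL2_mul_bounded _ _ (nsq ((2^-1)%:C%C * conjc (alpha l)))).
- apply: cmeasurableM; first exact: cmeasurable_cst.
  apply: cmeasurableC; apply: (cmeasurable_comp (f := tau R 0) (measurable_tau R 0)).
  by rewrite e_expt; exact: cmeasurable_expt.
- by move=> x; rewrite nsqM nsqC nsq_ephase mulr1.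
- apply: inL2D; first exact: (inL2_tau ss).
  by apply: inL2Z; exact: (inL2_tau ss).
Qed.

Lemma sum_nsq_dualop v x : \sum_(l <- L) nsq (dualop l v x) =
  2^-1 * (nsq (v (tau R 0 x)) + nsq (v (tau R b x))).
Proof.
set z := v _; set w := v _.
rewrite (eq_bigr (fun l => nsq (alpha l) * (4^-1 * nsq (z + csign l * w)))); last first.
  move=> l _; rewrite !nsqM nsqR !nsqC nsq_ephase mulr1; by field.
rewrite (weight_sum (fun l => 4^-1 * nsq (z + csign l * w)) uL L0 alpha0).
rewrite {1}/csign eqxx mul1r.
rewrite (eq_bigr (fun l => nsq (alpha l) * (4^-1 * nsq (z - w)))); last first.
  by move=> l l0; rewrite /csign (negbTE l0) mulN1r.
rewrite -mulr_suml hsum mul1r -mulrDr nsq_parallelogram; by field.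
Qed.

Lemma sum_nrm2_dualop v : inL2 mu v -> \sum_(l <- L) nrm2 mu (dualop l v) = nrm2 mu v.
Proof.
move=> hv; rewrite (nrm2_selfsimilar ss hv).
have i0 := (inL2P _ _).1 (inL2_tau ss in0 hv).
have ib := (inL2P _ _).1 (inL2_tau ss inb hv).
rewrite -RintegralD //; [|exact: i0.2|exact: ib.2].
rewrite -RintegralZl //; last exact: (rintegrableD i0.2 ib.2).
have hi l := ((inL2P _ _).1 (inL2_dualop l hv)).2.
have [_ <-] := Rintegral_sum_seq L hi.
by apply: eq_Rintegral => x _; exact: sum_nsq_dualop.
Qed.

Lemma freq_cons l w : freq R (l :: w) = l + R * freq R w.
Proof.
rewrite /freq big_ord_recl expr0 mul1r; congr (_ + _).
by rewrite mulr_sumr; apply: eq_bigr => i _; rewrite /= exprS mulrA.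
Qed.

Lemma freq_nil : freq R [::] = 0.
Proof. by rewrite /freq big_ord0. Qed.

Lemma frame_elt_zero : frame_elt R alpha [:: 0] = frame_elt R alpha [::].
Proof.
by apply/funext => x; rewrite /frame_elt big_cons alpha0 mul1r freq_cons freq_nil mulr0.
Qed.

Lemma frame_elt_cons_tau l w c x : c \in [:: 0; b] ->
  frame_elt R alpha (l :: w) (tau R c x) =
  alpha l * e_ l (tau R c x) * frame_elt R alpha w x.
Proof.
move=> cb; rewrite /frame_elt big_cons freq_cons.
have -> : e_ (l + R * freq R w) (tau R c x) = e_ l (tau R c x) * e_ (freq R w) x.
  rewrite /e_ rmorphD /= mulrDl ephaseD; congr (_ * _).
  rewrite rmorphM /= /tau mulrC mulrA mulfVK ?intR_neq0 // mulrDl.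
  by rewrite -rmorphM /= ephaseDint mulrC.
ring.
Qed.

Lemma nsq_frame_elt w x : nsq (frame_elt R alpha w x) = nsq (\prod_(l <- w) alpha l).
Proof. by rewrite nsqM nsq_ephase mulr1. Qed.

Lemma inL2_mul_frame_elt v w : inL2 mu v ->
  inL2 mu (fun x => v x * conjc (frame_elt R alpha w x)).
Proof.
move=> hv; under eq_fun do rewrite mulrC.
apply: (@inL2_mul_bounded _ _ (nsq (\prod_(l <- w) alpha l))) => //.
  apply: cmeasurableC; apply: cmeasurableM; first exact: cmeasurable_cst.
  exact: cmeasurable_expt.
by move=> x; rewrite nsqC nsq_frame_elt.
Qed.

Lemma inner_frame_elt_cons v l w : l \in L -> inL2 mu v ->
  inner mu v (frame_elt R alpha (l :: w)) = inner mu (dualop l v) (frame_elt R alpha w).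
Proof.
move=> lL hv; rewrite /inner (cintegral_selfsimilar ss); last exact: inL2_mul_frame_elt.
have h := inL2_mul_frame_elt (l :: w) hv.
rewrite -cintegralD; [|exact: (inL2_tau ss in0 h)|exact: (inL2_tau ss inb h)].
rewrite -cintegralZ; last exact: inL2D (inL2_tau ss in0 h) (inL2_tau ss inb h).
congr cintegral; apply/funext => x; rewrite !frame_elt_cons_tau // e_tau_b //.
by rewrite /dualop !conjcM csign_conj; ring.
Qed.

Lemma inner_nil v : inner mu v (frame_elt R alpha [::]) = cintegral mu v.
Proof.
rewrite /inner; congr cintegral; apply/funext => x.
rewrite /frame_elt big_nil /freq big_ord0 /e_ mul0r ephase0 mulr1.
by rewrite -[X in conjc X]/((1 : K)%:C%C) conjc_real mulr1.
Qed.

Lemma cintegral_dualop0 v : inL2 mu v -> cintegral mu (dualop 0 v) = cintegral mu v.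
Proof.
move=> hv; rewrite -!inner_nil -inner_frame_elt_cons //.
rewrite /inner; congr cintegral; apply/funext => x.
by rewrite frame_elt_zero.
Qed.

Fixpoint energy (k : nat) (v : K -> K[i]) : K :=
  if k is k'.+1 then \sum_(l <- L) energy k' (dualop l v) else nsq (cintegral mu v).

Lemma energy_ge0 k v : 0 <= energy k v.
Proof.
by elim: k v => [|k IHk] v; rewrite ?nsq_ge0 // sumr_ge0.
Qed.

Lemma dualopD l u v : dualop l (fun x => u x + v x) = fun x => dualop l u x + dualop l v x.
Proof. by apply/funext => x; rewrite /dualop; ring. Qed.

Lemma dualopZ l c v : dualop l (fun x => c * v x) = fun x => c * dualop l v x.
Proof. by apply/funext => x; rewrite /dualop; ring. Qed.

Lemma dualopB l u v : dualop l (fun x => u x - v x) = fun x => dualop l u x - dualop l v x.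
Proof. by apply/funext => x; rewrite /dualop; ring. Qed.

Lemma energyZ k c v : inL2 mu v -> energy k (fun x => c * v x) = nsq c * energy k v.
Proof.
elim: k v => [|k IHk] v hv /=; first by rewrite cintegralZ // nsqM.
by rewrite mulr_sumr; apply: eq_bigr => l _; rewrite dualopZ IHk //; exact: inL2_dualop.
Qed.

Lemma energy_parallelogram k u v : inL2 mu u -> inL2 mu v ->
  energy k (fun x => u x + v x) + energy k (fun x => u x - v x) =
  2 * energy k u + 2 * energy k v.
Proof.
elim: k u v => [|k IHk] u v hu hv /=.
  rewrite !cintegralD //; last exact: inL2N.
  have -> : cintegral mu (fun x => - v x) = - cintegral mu v.
    by rewrite -mulN1r -cintegralZ //; congr cintegral; apply/funext => x; rewrite mulN1r.
  exact: nsq_parallelogram.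
rewrite -big_split !mulr_sumr -big_split; apply: eq_bigr => l _ /=.
by rewrite dualopD dualopB IHk //; exact: inL2_dualop.
Qed.

Lemma energy_incr k v : inL2 mu v -> energy k v <= energy k.+1 v.
Proof.
elim: k v => [|k IHk] v hv.
  rewrite /= (bigD1_seq 0) //= cintegral_dualop0 // lerDl.
  by rewrite sumr_ge0 // => l _; exact: nsq_ge0.
by apply: ler_sum => l _; apply: IHk; exact: inL2_dualop.
Qed.


Lemma energy_le k v : inL2 mu v -> energy k v <= nrm2 mu v.
Proof.
elim: k v => [|k IHk] v hv; first exact: nsq_cintegral.
by rewrite -sum_nrm2_dualop //; apply: ler_sum => l _; apply: IHk; exact: inL2_dualop.
Qed.

Definition defect k v := nrm2 mu v - energy k v.

Lemma defect_ge0 k v : inL2 mu v -> 0 <= defect k v.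
Proof. by move=> hv; rewrite subr_ge0 energy_le. Qed.

Lemma defect_le k v : defect k v <= nrm2 mu v.
Proof. by rewrite gerBl energy_ge0. Qed.

Lemma defect_decr j k v : inL2 mu v -> (j <= k)%N -> defect k v <= defect j v.
Proof.
move=> hv /subnK <-; elim: (k - j)%N => [//|n]; apply: le_trans.
by rewrite lerD2l lerN2 energy_incr.
Qed.

Lemma defectZ k c v : inL2 mu v -> defect k (fun x => c * v x) = nsq c * defect k v.
Proof. by move=> hv; rewrite /defect nrm2Z // energyZ // mulrBr. Qed.

Lemma defectD k u v : inL2 mu u -> inL2 mu v ->
  defect k (fun x => u x + v x) <= 2 * defect k u + 2 * defect k v.
Proof.
move=> hu hv; have hB := inL2D hu (inL2N hv).
have := defect_ge0 k hB; have := energy_parallelogram k hu hv.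
have := nrm2_parallelogram hu hv; rewrite /defect; lra.
Qed.

Definition transcoef (l : int) (t : K) : K[i] :=
  (2^-1)%:C%C * conjc (alpha l) * (1 + csign l * ephase (t * b%:~R / R%:~R)).

Definition transprob (l : int) (t : K) : K := nsq (transcoef l t).

Lemma dualop_expt l t :
  dualop l (expt t) = fun x => transcoef l t * expt ((t - l%:~R) / R%:~R) x.
Proof.
apply/funext => x; rewrite /dualop /transcoef /e_ /expt /tau addr0 -ephaseN.
have -> : t * ((x + b%:~R) / R%:~R) = t * (x / R%:~R) + t * b%:~R / R%:~R by ring.
have -> : (t - l%:~R) / R%:~R * x = - (l%:~R * (x / R%:~R)) + t * (x / R%:~R) by ring.
by rewrite !ephaseD; ring.
Qed.

Lemma energy_expt k t : energy k.+1 (expt t) =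
  \sum_(l <- L) transprob l t * energy k (expt ((t - l%:~R) / R%:~R)).
Proof.
rewrite [LHS]/=; apply: eq_bigr => l _.
by rewrite dualop_expt (energyZ _ _ (inL2_expt mu _)).
Qed.

Lemma sum_transprob t : \sum_(l <- L) transprob l t = 1.
Proof.
rewrite -(nrm2_expt mu t) -sum_nrm2_dualop; last exact: inL2_expt.
apply: eq_bigr => l _; rewrite dualop_expt nrm2Z; last exact: inL2_expt.
by rewrite nrm2_expt mulr1.
Qed.

Lemma defect_expt k t : defect k.+1 (expt t) =
  \sum_(l <- L) transprob l t * defect k (expt ((t - l%:~R) / R%:~R)).
Proof.
rewrite /defect nrm2_expt energy_expt -{1}(sum_transprob t) -sumrB.
by apply: eq_bigr => l _; rewrite nrm2_expt mulrBr mulr1.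
Qed.

Lemma transprobE l t : transprob l t = nsq (alpha l) *
  ((1 + (if l == 0 then 1 else -1) * cos (2 * pi * (t * b%:~R / R%:~R))) / 2).
Proof.
rewrite /transprob /transcoef !nsqM nsqR nsqC /csign.
set y := t * _ / _; have := cos2Dsin2 (2 * pi * y).
set c := cos _; set s := sin _ => e.
have -> : nsq (1 + (if l == 0 then 1 else -1) * ephase y) =
    2 + 2 * (if l == 0 then 1 else -1) * c.
  case: ifP => _; rewrite /nsq /ephase /= -/c -/s.
    by transitivity (1 + 2 * c + (c ^+ 2 + s ^+ 2)); [ring|rewrite e; ring].
  by transitivity (1 - 2 * c + (c ^+ 2 + s ^+ 2)); [ring|rewrite e; ring].
by field.
Qed.

Lemma continuous_fourier (f : K -> K) : continuous f -> (forall x, `|f x| <= 1) ->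
  continuous (fun t : K => \int[mu]_x f (2 * pi * (t * x))).
Proof.
move=> cf f1 t.
have mf (s : K) : measurable_fun setT (fun x : K => f (2 * pi * (s * x))).
  apply: measurableT_comp; first exact: continuous_measurable_fun.
  by apply: measurable_funM => //; apply: measurable_funM.
apply: (@continuity_under_integral _ _ _ mu (fun t x => f (2 * pi * (t * x))) setT
  measurableT (t - 1) (t + 1) _ _ (cst 1)).
- by move=> s _; apply: rintegrable_le (rintegrable_cst mu 1) _ => //; exact: mf.
- apply: aeW => x _ s _; apply: continuous_comp; last exact: cf.
  by apply: cvgMl_tmp; apply: cvgMr_tmp.
- exact: rintegrable_cst.
- by move=> s _; apply: aeW => x _; exact: f1.
- by rewrite inE /= in_itv /=; apply/andP; split; lra.
Qed.

Lemma continuous_transprob l : continuous (transprob l).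
Proof.
have -> : transprob l = fun t => nsq (alpha l) *
    ((1 + (if l == 0 then 1 else -1) * cos (2 * pi * (t * b%:~R / R%:~R))) / 2).
  by apply/funext => t; exact: transprobE.
move=> t.
apply: cvgMl_tmp; apply: cvgMr_tmp; apply: cvgD; first exact: cvg_cst.
apply: cvgMl_tmp; apply: continuous_comp; last exact: continuous_cos.
by apply: cvgMl_tmp; apply: cvgMr_tmp; apply: cvgMr_tmp.
Qed.

Lemma continuous_defect_expt k : continuous (fun t => defect k (expt t)).
Proof.
elim: k => [|k IHk] t.
  rewrite /defect; under eq_fun do rewrite nrm2_expt.
  apply: cvgB; first exact: cvg_cst.
  apply: cvgD.
    rewrite expr2; under eq_fun do rewrite expr2.
    apply: cvgM; apply: continuous_fourier; try exact: continuous_cos;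
      by move=> x; rewrite ler_norml cos_le1 cos_geN1.
  rewrite expr2; under eq_fun do rewrite expr2.
  apply: cvgM; apply: continuous_fourier; try exact: continuous_sin;
    by move=> x; rewrite ler_norml sin_le1 sin_geN1.
have -> : (fun t => defect k.+1 (expt t)) = fun t =>
    \sum_(l <- L) transprob l t * defect k (expt ((t - l%:~R) / R%:~R)).
  by apply/funext => s; exact: defect_expt.
apply: continuous_sum_seq => l s; apply: cvgM; first exact: continuous_transprob.
apply: (@continuous_comp _ _ _ (fun t : K => (t - l%:~R) / R%:~R) (fun t => defect k (expt t))).
  by apply: cvgMr_tmp; apply: cvgB => //; exact: cvg_cst.
exact: IHk.
Qed.

Lemma defect0_expt0 : defect 0 (expt 0) = 0.
Proof.
rewrite /defect nrm2_expt /=.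
have -> : expt (0 : K) = fun=> 1 by apply/funext => x; rewrite /expt mul0r ephase0.
by rewrite cintegralE !Rintegral_cst_prob /nsq /= expr1n expr0n addr0 subrr.
Qed.

Hypothesis b0 : b != 0.
Hypothesis alpha_neq0 : forall l, l \in L -> alpha l != 0.
Hypothesis condv : condition_v R L.

Definition complete v := inL2 mu v /\ forall e, 0 < e -> exists k, defect k v < e.

Lemma complete_expt t : complete (expt t).
Proof.
split; first exact: inL2_expt.
have trE l s : transprob l s = stepprob R b (fun l => nsq (alpha l)) l s.
  exact: transprobE.
move=> e; apply: (@walk_converges _ R b L (fun l => nsq (alpha l))
  (fun k t => defect k (expt t))) => //.
- by move=> l lL; rewrite lt_neqAle nsq_ge0 eq_sym nsq_eq0 alpha_neq0.
- by move=> s; rewrite -(sum_transprob s); apply: eq_bigr => l _; rewrite trE.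
- exact: continuous_defect_expt.
- by move=> i j s ij; apply: defect_decr => //; exact: inL2_expt.
- by move=> k s; rewrite defect_expt; apply: eq_bigr => l _; rewrite trE.
- by move=> k s; apply: defect_ge0; exact: inL2_expt.
- exact: defect0_expt0.
Qed.

Lemma complete_inL2 v : inL2 mu v -> complete v.
Proof.
apply: trigpoly_dense => {v}.
- by move=> v [].
- exact: complete_expt.
- move=> u v [hu cu] [hv cv]; split; first exact: inL2D.
  move=> e e0; have e4 : 0 < e / 4 by rewrite divr_gt0.
  have [i hi] := cu _ e4; have [j hj] := cv _ e4; exists (maxn i j).
  apply: le_lt_trans (defectD _ hu hv) _.
  have := defect_decr hu (leq_maxl i j); have := defect_decr hv (leq_maxr i j); lra.
- move=> c v [hv cv]; split; first exact: inL2Z.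
  move=> e e0; have c1 : 0 < nsq c + 1 by rewrite ltr_wpDl ?nsq_ge0.
  have [k hk] := cv _ (divr_gt0 e0 c1); exists k; rewrite defectZ //.
  apply: (@le_lt_trans _ _ ((nsq c + 1) * defect k v)).
    by rewrite ler_wpM2r ?defect_ge0 // lerDl.
  by rewrite mulrC -ltr_pdivlMr.
- move=> v hv app; split=> // e e0; have e4 : 0 < e / 4 by rewrite divr_gt0.
  have [u [[hu cu] uv]] := app _ e4; have [k hk] := cu _ e4; exists k.
  have hB := inL2D hv (inL2N hu).
  have -> : v = (fun x => u x + (v x - u x)) by apply/funext => x; rewrite addrC subrK.
  apply: le_lt_trans (defectD _ hu hB) _.
  by have := defect_le k (fun x => v x - u x); lra.
Qed.

Fixpoint words (k : nat) : seq (seq int) :=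
  if k is k'.+1 then
    [::] :: [seq lw <- [seq l :: w | l <- L, w <- words k'] | lw != [:: 0]]
  else [:: [::]].

Lemma nil_words k : [::] \in words k.
Proof. by case: k => [|k]; rewrite inE. Qed.

Lemma mem_wordsS k l w :
  (l :: w \in words k.+1) = [&& l \in L, w \in words k & l :: w != [:: 0]].
Proof.
rewrite /= inE /= mem_filter andbC andbA; congr (_ && _).
apply/allpairsP/andP => [[[l' w'] /= [? ? [-> ->]]] //|[lL wk]].
by exists (l, w).
Qed.

Lemma uniq_words k : uniq (words k).
Proof.
elim: k => //= k IHk; apply/andP; split.
  by rewrite mem_filter /=; apply/negP => /allpairsP[[? ?] [_ _ //]].
by apply: filter_uniq; apply: allpairs_uniq => // -[? ?] [? ?] _ _ /= [-> ->].
Qed.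

Lemma words_Omega k w : w \in words k -> Omega L w.
Proof.
elim: k w => [|k IHk] [|l w] //; try by move=> _; split=> //; left.
rewrite mem_wordsS => /and3P[lL /IHk[aw lw] ne]; split; first by rewrite /= lL.
right; move: lw ne; case: w aw => [_ _|l' w _ [] //=].
by rewrite /= eqseq_cons eqxx andbT.
Qed.

Lemma Omega_words k w : Omega L w -> (size w <= k)%N -> w \in words k.
Proof.
elim: k w => [|k IHk] [|l w] // [/= /andP[lL aw] [//|lw]] sw.
rewrite mem_wordsS lL /=; apply/andP; split; last first.
  by apply: contraNneq lw => -[-> ->].
by apply: IHk => //; split=> //; case: w lw {aw sw} => [|l' w] lw; [left|right].
Qed.

Lemma sum_words k v : inL2 mu v ->
  \sum_(w <- words k) nsq (inner mu v (frame_elt R alpha w)) = energy k v.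
Proof.
elim: k v => [|k IHk] v hv; first by rewrite big_seq1 inner_nil.
rewrite /= big_cons big_filter.
pose F w := nsq (inner mu v (frame_elt R alpha w)).
have e : \sum_(w <- [seq l :: w | l <- L, w <- words k]) F w =
    \sum_(l <- L) energy k (dualop l v).
  rewrite big_allpairs_dep /= big_seq [RHS]big_seq; apply: eq_bigr => l lL.
  rewrite -IHk; last exact: inL2_dualop.
  by apply: eq_bigr => w _; rewrite /F inner_frame_elt_cons.
rewrite -e (bigD1_seq [:: 0]) //=; first by rewrite /F frame_elt_zero.
  by apply/allpairsP; exists (0, [::]); split=> //; exact: nil_words.
by apply: allpairs_uniq => //; [exact: uniq_words|move=> [? ?] [? ?] _ _ /= [-> ->]].
Qed.

Lemma frame_parseval : parseval_frame (Omega L) mu (frame_elt R alpha).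
Proof.
move=> v hv; have [_ iv] := (inL2P _ _).1 hv.
have -> : (\int[mu]_x (Normc.normc (v x) ^+ 2)%:E = (nrm2 mu v)%:E)%E.
  rewrite /nrm2 /Rintegral fineK; last exact: (integrable_fin_num measurableT iv).
  by apply: eq_integral => x _; rewrite normc_sqr.
under eq_esum do rewrite normc_sqr.
pose F w := nsq (inner mu v (frame_elt R alpha w)).
have sumE k : (\sum_(w \in [set` words k]) (F w)%:E = (energy k v)%:E)%E.
  by rewrite -fsbig_seq ?uniq_words // sumEFin sum_words.
apply/eqP; rewrite eq_le; apply/andP; split.
  apply: ub_ereal_sup => _ [X [finX XO] <-].
  have [k Xk] : exists k, X `<=` [set` words k].
    exists (\max_(w <- finmap.enum_fset (fset_set X)) size w)%N => w Xw.
    apply: Omega_words; first exact: XO.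
    by apply: leq_bigmax_seq => //; rewrite in_fset_set // inE.
  apply: (@le_trans _ _ (energy k v)%:E); last by rewrite lee_fin energy_le.
  rewrite -sumE; apply: lee_fsum_nneg_subset => //.
  - exact: finite_seq.
  - by move=> w; rewrite !inE; exact: Xk.
  - by move=> w _; rewrite lee_fin nsq_ge0.
apply/lee_addgt0Pr => e e0.
have [_ /(_ e e0)[k hk]] := complete_inL2 hv.
apply: (@le_trans _ _ ((energy k v)%:E + e%:E)%E).
  by rewrite -EFinD lee_fin; move: hk; rewrite /defect; lra.
rewrite leeD2r //; apply: esum_ge; exists [set` words k].
  by split; [exact: finite_seq|move=> w; exact: words_Omega].
by rewrite sumE.
Qed.

End Frame.

Unset Implicit Arguments.

Theorem theorem5p6 (K : realType) (R b : int) (L : seq int) (alpha : int -> K[i]) :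
  (2 <= `|R|)%R -> b != 0 -> uniq L -> 0 \in L ->
  (forall l, l \in L -> alpha l != 0) -> alpha 0 = 1 ->
  (orthonormal_columns R b L alpha <-> conditions_i_iv R b L alpha) /\
  (conditions_i_iv R b L alpha -> condition_v R L ->
   forall mu : probability K K, selfsimilar R b mu ->
     parseval_frame (Omega L) mu (frame_elt R alpha)).
Proof.
move=> R2 b0 uL L0 an0 a0.
have R0 : R != 0 by apply: contraTneq R2 => ->.
have condE := conditions_half_odd L alpha R0 b0.
split; first exact: iff_trans (orthonormal_half_odd R0 b0 uL L0 an0 a0) (iff_sym condE).
move=> /condE[hL hs] cv mu ss.
apply: (@frame_parseval K mu R b L alpha) => //.
by rewrite -[RHS]hs; apply: eq_bigr => l _; rewrite normc_sqr.
Qed.
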